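(* Assume the following. (i) $X_0$ is an $\mathbb R^d$-valued $\mathcal F_0^W$-measurable random variable, independent of the pair $(W,(\tau_j)_{j\ge1})$, with $\mathbb E[|X_0|^q]<\infty$ for every $q\ge1$. (ii) There exist constants $K>0$ and $\kappa\ge0$ such that for all $s,t\in[0,T]$ and $x,y\in\mathbb R^d$: $|f(t,x)-f(t,y)|\le K(1+|x|^\kappa+|y|^\kappa)|x-y|$; $\sup_{t\in[0,T]}|f(t,0)|<\infty$; $|f(t,x)-f(s,x)|\le K(1+|x|^{\kappa+1})|t-s|^{1/2}$; and $\langle x-y,f(t,x)-f(t,y)\rangle\le K|x-y|^2$. (iii) For each $r=1,\dots,m$ and each fixed $t\in[0,T]$ the map $x\mapsto g^r(t,x)$ is continuously differentiable, and there is a constant $K>0$ such that for all $s,t\in[0,T]$, $x,y\in\mathbb R^d$ and $r,r_1,r_2\in\{1,\dots,m\}$: $\sup_{t\in[0,T]}|g^r(t,0)|<\infty$; $|g^r(t,x)-g^r(t,y)|\le K|x-y|$; $|\partial_xg^r(t,x)|\le K$; $|\partial_xg^r(t,x)-\partial_xg^r(t,y)|\le K|x-y|$; $|g^{r_1,r_2}(t,x)-g^{r_1,r_2}(t,y)|\le K|x-y|$; and $|g^r(t,x)-g^r(s,x)|\le K(1+|x|)|t-s|$. Let $0<\alpha<\frac1{2(\kappa+1)}$ be the projection parameter. Let $j\in\{1,\dots,N\}$, and let $Y,Z$ be $\mathbb R^d$-valued $\mathcal F_{j-1}^h$-measurable random variables such that for every $q\ge1$ there is a constant $C_q>0$, independent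 of $h_j$, with $\mathbb E[|Y|^q]+\mathbb E[|Z|^q]\le C_q$. Set $t_{j,\tau}:=t_{j-1}+\tau_jh_j$ and, for $y\in\mathbb R^d$, $$\psi_j^\tau(y)=y+\tau_jh_jf_{h_j}(t_{j-1},y)+\sum_{r=1}^mg^r(t_{j-1},y)I^{(r)}_{t_{j-1},t_{j,\tau}},$$ $$\Phi_j(y)=h_jf_{h_j}\bigl(t_{j,\tau},\psi_j^\tau(y)\bigr)+\sum_{r=1}^mg^r(t_{j-1},y)I^{(r)}_{t_{j-1},t_j}+\sum_{r_1,r_2=1}^mg^{r_1,r_2}(t_{j-1},y)I^{(r_2,r_1)}_{t_{j-1},t_j}.$$ Then there exists a constant $C>0$, independent of $h_j$, such that $$\mathbb E\left[\left|Y-Z+\Phi_j(Y)-\Phi_j(Z)\right|^2\right]\le(1+Ch_j)\,\mathbb E\left[|Y-Z|^2\right]+Ch_j^3,$$ and moreover $$\mathbb E\left[\left|\Phi_j(Y)-\Phi_j(Z)\right|^2\right]\le Ch_j\,\mathbb E\left[|Y-Z|^2\right].$$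
   Context: Setting. $T>0$ is fixed. $(\Omega_W,\mathcal F^W,(\mathcal F^W_t)_{t\in[0,T]},\mathbb P_W)$ is a filtered probability space satisfying the usual conditions, carrying an $m$-dimensional Brownian motion $W=(W^1,\dots,W^m)$ (with respect to this filtration). $(\Omega_\tau,\mathcal F^\tau,\mathbb P_\tau)$ is another probability space carrying an i.i.d. sequence $(\tau_j)_{j\ge1}$ of random variables uniformly distributed on $(0,1)$. Everything is considered on the product space $(\Omega,\mathcal F,\mathbb P)=(\Omega_W\times\Omega_\tau,\mathcal F^W\otimes\mathcal F^\tau,\mathbb P_W\otimes\mathbb P_\tau)$; random variables on a factor are identified with their extensions, so $(\tau_j)$ is independent of $W$. $|\cdot|$ is the Euclidean norm for vectors and the Frobenius norm for matrices; $\langle\cdot,\cdot\rangle$ is the Euclidean inner product. Coefficients: $f,g^1,\dots,g^m:[0,T]\times\mathbb R^d\to\mathbb R^d$. Put $g^{r_1,r_2}(t,x)=\partial_xg^{r_1}(t,x)\,g^{r_2}(t,x)\in\mathbb R^d$, with $\partial_xg^{r_1}$ the Jacobian matrix in $x$. Stochastic integrals: for $0\le s<t\le T$, $I_{s,t}^{(r)}=W^r(t)-W^r(s)$ and $I_{s,t}^{(r_1,r_2)}=\int_s^t\int_s^{u_1}dW^{r_1}(u_2)\,dW^{r_2}(u_1)$. Grid and filtration: $0=t_0<t_1<\dots<t_N=T$, $h_j=t_j-t_{j-1}$, $h=\max_jh_j$, with $0<h\le1$; $\mathcal F_j^\tau=\sigma(\tau_1,\dots,\tau_j)$, $\mathcal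 F_0^\tau=\{\emptyset,\Omega_\tau\}$, $\mathcal F_j^h=\mathcal F_{t_j}^W\otimes\mathcal F_j^\tau$. Projection: for a step size $h\in(0,1]$, $T_h(x)=x\min(1,h^{-\alpha}/|x|)$, $T_h(0)=0$, and $f_h(t,x)=f(t,T_h(x))$. Constants are independent of the step size and of the time index; here $C$ may depend on the moment constants $(C_q)_{q\ge1}$, on $T,d,m,\alpha$ and on the constants in the assumptions, but the same $C$ works for all grids with $h\le1$, all $j$, and all $Y,Z$ satisfying the moment bounds with the given $C_q$. *)

(* Defs.v *)
From HB Require Import structures.
From mathcomp Require Import all_boot all_order all_algebra.
From mathcomp Require Import all_classical all_reals all_analysis.

Set Implicit Arguments.
Unset Strict Implicit.
Unset Printing Implicit Defensive.

Import Order.TTheory GRing.Theory Num.Theory.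
Import numFieldNormedType.Exports.

Local Open Scope classical_set_scope.
Local Open Scope ring_scope.

(* Euclidean norm of a vector, Frobenius norm of a matrix; the library's
   canonical norm on matrices is the maximum norm. *)
Definition fnorm (R : realType) (p q : nat) (A : 'M[R]_(p, q)) : R :=
  Num.sqrt (\sum_i \sum_j A i j ^+ 2).

Definition inner (R : realType) (d : nat) (u v : 'rV[R]_d) : R :=
  \sum_i u ord0 i * v ord0 i.

Definition sigma_gen (R : realType) (Omega I : Type) (D : set I)
    (X : I -> Omega -> R) : set (set Omega) :=
  <<s \bigcup_(i in D) preimage_set_system setT (X i) measurable >>.

Definition sigma_prod (Omega1 Omega2 : Type) (F1 : set (set Omega1))
    (F2 : set (set Omega2)) : set (set (Omega1 * Omega2)) :=
  <<s [set A `*` B | A in F1 & B in F2] >>.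

Definition sub_measurable (R : realType) (Omega : Type) (G : set (set Omega))
    (X : Omega -> R) : Prop :=
  preimage_set_system setT X measurable `<=` G.

Definition sub_measurable_vec (R : realType) (d : nat) (Omega : Type)
    (G : set (set Omega)) (X : Omega -> 'rV[R]_d) : Prop :=
  forall i, sub_measurable G (fun w => X w ord0 i).

Definition independent_classes (R : realType) (dd : measure_display)
    (Omega : measurableType dd) (P : probability Omega R)
    (G H : set (set Omega)) : Prop :=
  forall A B, G A -> H B -> P (A `&` B) = (P A * P B)%E.

(* Filtrations are functions on R of which only the values on [0, T] matter. *)

Section filtered_space.
Context (R : realType) (dd : measure_display) (Omega : measurableType dd).
Variables (P : probability Omega R) (T : R).

Definition filtration (F : R -> set (set Omega)) : Prop :=
  [/\ forall t, 0 <= t <= T -> sigma_algebra setT (F t),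
      forall t, 0 <= t <= T -> F t `<=` measurable &
      forall s t, 0 <= s -> s <= t -> t <= T -> F s `<=` F t].

(* [P.-negligible] covers all subsets of null events, so the completeness
   clause also makes the underlying probability space complete. *)
Definition usual_conditions (F : R -> set (set Omega)) : Prop :=
  [/\ filtration F,
      forall A, P.-negligible A -> F 0 A &
      forall t, 0 <= t < T -> F t = \bigcap_(s in [set s | t < s <= T]) F s].

(* The last clause says at once that the increment W_t - W_s is independent of
   F_s and that its components are independent with law N(0, t - s); the second
   parameter of [normal_prob] is the standard deviation. *)
Definition brownian_motion (F : R -> set (set Omega)) (m : nat)
    (W : 'I_m -> R -> Omega -> R) : Prop :=
  [/\ forall r t, 0 <= t <= T -> sub_measurable (F t) (W r t),
      forall r, {ae P, forall w, W r 0 w = 0},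
      forall r w, {within `[0, T], continuous (fun t => W r t w)} &
      forall s t, 0 <= s -> s < t -> t <= T ->
      forall (A : set Omega) (B : 'I_m -> set R), F s A ->
        (forall r, measurable (B r)) ->
        P (A `&` [set w | forall r, B r (W r t w - W r s w)]) =
        (P A * \prod_(r < m) normal_prob 0 (Num.sqrt (t - s)) (B r))%E].

End filtered_space.

(* The simple process sum_(k < n) xi_k 1_(]p_k, p_(k+1)]). *)
Record simple_process (R : realType) (Omega : Type) := SimpleProcess {
  sp_size : nat;
  sp_node : nat -> R;
  sp_coef : nat -> Omega -> R }.

Section ito.
Context (R : realType) (dd : measure_display) (Omega : measurableType dd).
Variables (P : probability Omega R) (F : R -> set (set Omega)).
Variable B : R -> Omega -> R.

Definition simple_on (s t : R) (h : simple_process R Omega) : Prop :=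
  [/\ sp_node h 0 = s, sp_node h (sp_size h) = t,
      forall k, (k < sp_size h)%N -> sp_node h k < sp_node h k.+1 &
      forall k, (k < sp_size h)%N ->
        sub_measurable (F (sp_node h k)) (sp_coef h k) /\
        exists M, forall w, `|sp_coef h k w| <= M].

Definition simple_value (h : simple_process R Omega) (u : R) (w : Omega) : R :=
  \sum_(k < sp_size h)
     sp_coef h k w * \1_(`]sp_node h k, sp_node h k.+1]) u.

Definition simple_integral (h : simple_process R Omega) (w : Omega) : R :=
  \sum_(k < sp_size h)
     sp_coef h k w * (B (sp_node h k.+1) w - B (sp_node h k) w).

(* [J] is a version of the Ito integral of [H] with respect to [B] over [s, t],
   the L^2 limit of the elementary integrals of simple processes converging to
   [H] in L^2(P x du). *)
Definition is_ito_integral (s t : R) (H : R -> Omega -> R) (J : Omega -> R)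
    : Prop :=
  measurable_fun setT J /\
  exists h : nat -> simple_process R Omega,
  [/\ forall k, simple_on s t (h k),
      (\int[P]_w \int[lebesgue_measure]_(u in `[s, t])
         ((simple_value (h k) u w - H u w)%R ^+ 2)%:E)%E
        @[k --> \oo] --> (0 : \bar R) &
      ('E_P[fun w => ((simple_integral (h k) w - J w) ^+ 2)%R])%E
        @[k --> \oo] --> (0 : \bar R)].

End ito.

Definition I1 (R : realType) (Omega : Type) (m : nat)
    (W : 'I_m -> R -> Omega -> R) (r : 'I_m) (s t : R) (w : Omega) : R :=
  W r t w - W r s w.

(* [I2 r1 r2 s t] is a version of the iterated integral in which the inner
   integrator is W^r1 and the outer one is W^r2. *)
Definition iterated_integrals (R : realType) (dd : measure_display)
    (Omega : measurableType dd) (P : probability Omega R) (T : R)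
    (F : R -> set (set Omega)) (m : nat) (W : 'I_m -> R -> Omega -> R)
    (I2 : 'I_m -> 'I_m -> R -> R -> Omega -> R) : Prop :=
  forall r1 r2 s t, 0 <= s -> s < t -> t <= T ->
    is_ito_integral P F (W r2) s t (fun u => I1 W r1 s u) (I2 r1 r2 s t).

(* The sequence is tau 1, tau 2, ...; tau 0 is unused. In the last clause some
   of the B j may be setT, so it covers all finite subfamilies. *)
Definition iid_uniform (R : realType) (dd : measure_display)
    (Omega : measurableType dd) (P : probability Omega R)
    (tau : nat -> Omega -> R) : Prop :=
  [/\ forall j, (0 < j)%N -> measurable_fun setT (tau j),
      forall j w, (0 < j)%N -> 0 < tau j w < 1,
      forall j (B : set R), (0 < j)%N -> measurable B ->
        P (tau j @^-1` B) = uniform_prob (@ltr01 R) B &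
      forall n (B : nat -> set R), (forall j, measurable (B j)) ->
        P [set w | forall j, (0 < j <= n)%N -> B j (tau j w)] =
        (\prod_(1 <= j < n.+1) P (tau j @^-1` B j))%E].

Definition sigma_tau (R : realType) (Omega : Type) (tau : nat -> Omega -> R)
    (j : nat) : set (set Omega) :=
  sigma_gen [set i | (0 < i <= j)%N] tau.

Section initial_value.
Context (R : realType) (d1 d2 : measure_display).
Context (OW : measurableType d1) (Otau : measurableType d2).
Variables (PW : probability OW R) (Ptau : probability Otau R) (T : R).

Definition sigma_noise (m : nat) (W : 'I_m -> R -> OW -> R)
    (tau : nat -> Otau -> R) : set (set (OW * Otau)) :=
  sigma_gen
    [set i : 'I_m * R + nat | match i with
       | inl rt => 0 <= rt.2 <= T
       | inr j => (0 < j)%N end]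
    (fun i w => match i with
       | inl rt => W rt.1 rt.2 w.1
       | inr j => tau j w.2 end).

Definition initial_value (F : R -> set (set OW)) (m : nat)
    (W : 'I_m -> R -> OW -> R) (tau : nat -> Otau -> R) (d : nat)
    (X0 : OW -> 'rV[R]_d) : Prop :=
  [/\ sub_measurable_vec (F 0) X0,
      independent_classes (PW \x Ptau)%E
        (sigma_gen setT (fun i w => X0 w.1 ord0 i)) (sigma_noise W tau) &
      forall q : R, 1 <= q -> ('E_PW[fun w => (fnorm (X0 w) `^ q)%R] < +oo)%E].

End initial_value.

(* Vectors of R^d are row vectors, so the library's Jacobian ['J]
   is the transpose of the usual one and acts on vectors from the right. *)

Section coefficients.
Context (R : realType) (d : nat).
Implicit Types (x y : 'rV[R]_d).

(* [M] bounds the supremum of |f(t, 0)| over t in [0, T]. *)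
Definition drift_assumption (T K kappa M : R) (f : R -> 'rV[R]_d -> 'rV[R]_d)
    : Prop :=
  [/\ forall t x y, 0 <= t <= T ->
        fnorm (f t x - f t y) <=
        K * (1 + fnorm x `^ kappa + fnorm y `^ kappa) * fnorm (x - y),
      forall t, 0 <= t <= T -> fnorm (f t 0) <= M,
      forall s t x, 0 <= s <= T -> 0 <= t <= T ->
        fnorm (f t x - f s x) <=
        K * (1 + fnorm x `^ (kappa + 1)) * `|t - s| `^ (2^-1) &
      forall t x y, 0 <= t <= T ->
        inner (x - y) (f t x - f t y) <= K * fnorm (x - y) ^+ 2].

Context (m : nat).
Implicit Types (g : 'I_m -> R -> 'rV[R]_d -> 'rV[R]_d).

Definition gprod g (r1 r2 : 'I_m) (t : R) x : 'rV[R]_d :=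
  g r2 t x *m jacobian (g r1 t) x.

Definition diffusion_assumption (T K M : R) g : Prop :=
  (forall r t, 0 <= t <= T ->
     (forall x, differentiable (g r t) x) /\ continuous (jacobian (g r t))) /\
  [/\ forall r t, 0 <= t <= T -> fnorm (g r t 0) <= M,
      forall r t x y, 0 <= t <= T ->
        fnorm (g r t x - g r t y) <= K * fnorm (x - y),
      forall r t x y, 0 <= t <= T ->
        fnorm (jacobian (g r t) x) <= K /\
        fnorm (jacobian (g r t) x - jacobian (g r t) y) <= K * fnorm (x - y),
      forall r1 r2 t x y, 0 <= t <= T ->
        fnorm (gprod g r1 r2 t x - gprod g r1 r2 t y) <= K * fnorm (x - y) &
      forall r s t x, 0 <= s <= T -> 0 <= t <= T ->
        fnorm (g r t x - g r s x) <= K * (1 + fnorm x) * `|t - s|].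

(* T_h(x) = x min(1, h^(-alpha) / |x|). At x = 0 this is 0, as required, since
   division by 0 is total and the factor multiplies x. *)
Definition proj (alpha h : R) x : 'rV[R]_d :=
  Num.min 1 (h `^ (- alpha) / fnorm x) *: x.

Definition fproj (alpha h : R) (f : R -> 'rV[R]_d -> 'rV[R]_d) (t : R) x :=
  f t (proj alpha h x).

End coefficients.

Definition step (R : realType) (t : nat -> R) (j : nat) : R := t j - t j.-1.

Definition mesh (R : realType) (N : nat) (t : nat -> R) : R :=
  \big[Num.max/0]_(1 <= j < N.+1) step t j.

(* Only t 0, ..., t N matter. *)
Definition grid (R : realType) (T : R) (N : nat) (t : nat -> R) : Prop :=
  [/\ t 0 = 0, t N = T & forall j, (j < N)%N -> t j < t j.+1].

Section scheme.
Context (R : realType) (OW Otau : Type) (d m : nat).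
Variables (alpha : R).
Variables (f : R -> 'rV[R]_d -> 'rV[R]_d).
Variables (g : 'I_m -> R -> 'rV[R]_d -> 'rV[R]_d).
Variables (W : 'I_m -> R -> OW -> R).
Variables (I2 : 'I_m -> 'I_m -> R -> R -> OW -> R).
Variables (tau : nat -> Otau -> R) (t : nat -> R) (j : nat).

Let h := step t j.

Definition rtime (w : Otau) : R := t j.-1 + tau j w * h.

Definition psi (y : 'rV[R]_d) (w : OW * Otau) : 'rV[R]_d :=
  y + (tau j w.2 * h) *: fproj alpha h f (t j.-1) y +
  \sum_(r < m) I1 W r (t j.-1) (rtime w.2) w.1 *: g r (t j.-1) y.

(* The indices of I2 are swapped with respect to those of g^{r1,r2}. *)
Definition Phi (y : 'rV[R]_d) (w : OW * Otau) : 'rV[R]_d :=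
  h *: fproj alpha h f (rtime w.2) (psi y w) +
  \sum_(r < m) I1 W r (t j.-1) (t j) w.1 *: g r (t j.-1) y +
  \sum_(r1 < m) \sum_(r2 < m)
     I2 r2 r1 (t j.-1) (t j) w.1 *: gprod g r1 r2 (t j.-1) y.

End scheme.

(* Main.v *)
Require Import Defs.
From HB Require Import structures.
From mathcomp Require Import all_boot all_order all_algebra.
From mathcomp Require Import all_classical all_reals all_analysis.
From mathcomp Require Import measurable_realfun ring lra.

Set Implicit Arguments.
Unset Strict Implicit.
Unset Printing Implicit Defensive.

Import Order.TTheory GRing.Theory Num.Theory.
Import numFieldNormedType.Exports.

Local Open Scope classical_set_scope.
Local Open Scope ring_scope.

(** Write s for the left end point of the step, h for its length, D = Y - Z, and
    let the Brownian space and the space of the randomization be coordinates of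
    the product space.

    The argument begins with a fixed value of the randomization: the sections of
    Y and Z are then measurable for the past F_s, so that only the conditional
    behaviour of the Brownian increments and of the iterated integrals given F_s
    matters.
    The resulting estimate is then integrated over the randomization with the
    half of Tonelli's theorem that bounds a lower integral
    ([lower_integral_prod_le]); it does not require the scheme to be jointly
    measurable, since on each section the integrand only has to be dominated by a
    measurable function.

    For fixed tau_j the estimate is first pointwise, with the values of the
    stochastic integrals as parameters ([increment_stability],
    [increment_diff_le]). The projection is nonexpansive and maps into the ball
    of radius h^(-alpha), on which f is Lipschitz with a constant of order
    h^(-alpha kappa); since alpha kappa < 1/2, multiplication by h makes this
    O(h^(1/2)). In the expansion of |D + Phi(Y) - Phi(Z)|^2 the critical term is
    2 h <D, f(T_h psi(Y)) - f(T_h psi(Z))>. The one-sided Lipschitz condition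
    controls it with D replaced by T_h psi(Y) - T_h psi(Z); the difference
    consists of D - (psi(Y) - psi(Z)), which is of order h^(1/2) |D|, and of the
    residuals x - T_h x at psi(Y) and psi(Z). All remaining terms except one are
    bounded by |D|^2 times a random coefficient ([noise]) that involves only the
    squares of the increments and of the iterated integrals. The exception is
    2 sum_r <D, g^r(s, Y) - g^r(s, Z)> I^r, which has mean zero.

    A residual x - T_h x vanishes unless |x| > h^(-alpha), hence
    |x - T_h x|^2 <= h^3 |x|^(2p+2) as soon as 2 p alpha >= 3
    ([sqr_resid_le]). Together with the moments of Y, Z and of the Gaussian
    increments this produces the term C h^3.

    It remains to see that the coefficient has conditional expectation O(h)
    ([noise_moment]). The increments are Gaussian and independent of F_s: the
    joint law of the increment and the past is a product measure
    ([ge0_expectation_indep]), and upper bounds for even moments suffice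
    ([normal_moment_le]). For the iterated integrals one needs
    E[X J^2] <= C h^2 E[X] for nonnegative F_s-measurable X ([ito_moment]); this
    follows from one half of the Ito isometry for simple processes
    ([simple_integral_moment]) by passing to the limit. *)

(** * Euclidean geometry and the projection *)

Section euclidean.
Context (R : realType) (d : nat).
Implicit Types (x y z : 'rV[R]_d) (a b c h : R).

Lemma fnorm_ge0 p q (A : 'M[R]_(p, q)) : 0 <= fnorm A.
Proof. exact: sqrtr_ge0. Qed.

Lemma innerC x y : inner x y = inner y x.
Proof. by apply: eq_bigr => i _; rewrite mulrC. Qed.

Lemma innerDl x y z : inner (x + y) z = inner x z + inner y z.
Proof. by rewrite -big_split; apply: eq_bigr => i _; rewrite mxE mulrDl. Qed.

Lemma innerZl a x y : inner (a *: x) y = a * inner x y.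
Proof. by rewrite mulr_sumr; apply: eq_bigr => i _; rewrite mxE mulrA. Qed.

Lemma innerNl x y : inner (- x) y = - inner x y.
Proof. by rewrite -scaleN1r innerZl mulN1r. Qed.

Lemma innerDr x y z : inner x (y + z) = inner x y + inner x z.
Proof. by rewrite innerC innerDl !(innerC _ x). Qed.

Lemma innerZr a x y : inner x (a *: y) = a * inner x y.
Proof. by rewrite innerC innerZl innerC. Qed.

Lemma innerNr x y : inner x (- y) = - inner x y.
Proof. by rewrite innerC innerNl innerC. Qed.

Lemma inner_sumr (I : Type) (s : seq I) x (F : I -> 'rV[R]_d) :
  inner x (\sum_(i <- s) F i) = \sum_(i <- s) inner x (F i).
Proof.
elim: s => [|i s IH]; last by rewrite !big_cons innerDr IH.
by rewrite !big_nil /inner big1 // => i _; rewrite mxE mulr0.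
Qed.

Definition innerE := (innerDl, innerDr, innerZl, innerZr, innerNl, innerNr).

Lemma sqr_fnorm x : fnorm x ^+ 2 = inner x x.
Proof.
rewrite /fnorm big_ord1 sqr_sqrtr; last by apply: sumr_ge0 => i _; exact: sqr_ge0.
by apply: eq_bigr => i _; rewrite expr2.
Qed.

Lemma fnorm0 p q : fnorm (0 : 'M[R]_(p, q)) = 0.
Proof.
rewrite /fnorm big1 ?sqrtr0 // => i _; rewrite big1 // => j _.
by rewrite mxE expr0n.
Qed.

Lemma fnorm_eq0 x : fnorm x = 0 -> x = 0.
Proof.
move=> x0; have : inner x x == 0 by rewrite -sqr_fnorm x0 expr0n.
rewrite psumr_eq0 => [/allP e|i _]; last by rewrite -expr2 sqr_ge0.
apply/rowP => i; rewrite mxE; apply/eqP.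
by have := e i (mem_index_enum _); rewrite /= -expr2 sqrf_eq0.
Qed.

Lemma fnormZ a x : fnorm (a *: x) = `|a| * fnorm x.
Proof.
apply/eqP; rewrite -(@eqrXn2 _ 2) ?mulr_ge0 ?fnorm_ge0 //.
by rewrite exprMn !sqr_fnorm !innerE real_normK ?num_real // mulrA expr2.
Qed.

Lemma fnormN x : fnorm (- x) = fnorm x.
Proof. by rewrite -scaleN1r fnormZ normrN1 mul1r. Qed.

(** The Cauchy-Schwarz inequality. *)
Lemma inner_le x y : inner x y <= fnorm x * fnorm y.
Proof.
have [x0|nx] := eqVneq (fnorm x) 0.
  rewrite x0 mul0r /inner (fnorm_eq0 x0) big1 // => i _.
  by rewrite mxE mul0r.
have [y0|ny] := eqVneq (fnorm y) 0.
  rewrite y0 mulr0 /inner (fnorm_eq0 y0) big1 // => i _.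
  by rewrite mxE mulr0.
(* Expand the square of |y| x - |x| y and divide by |x| |y|. *)
have xy0 : 0 < fnorm x * fnorm y by rewrite mulr_gt0 // lt0r fnorm_ge0 ?nx ?ny.
have : 0 <= fnorm (fnorm y *: x - fnorm x *: y) ^+ 2 by exact: sqr_ge0.
rewrite sqr_fnorm !innerE (innerC y x) -!sqr_fnorm.
set a := fnorm x in xy0 *; set b := fnorm y in xy0 *; set c := inner x y => H.
rewrite -(ler_pM2l xy0); nra.
Qed.

Lemma ler_norm_inner x y : `|inner x y| <= fnorm x * fnorm y.
Proof.
rewrite ler_norml inner_le andbT lerNl -innerNl.
by rewrite (le_trans (inner_le _ _)) // fnormN.
Qed.

Lemma fnormD x y : fnorm (x + y) <= fnorm x + fnorm y.
Proof.
rewrite -(@ler_pXn2r _ 2) ?nnegrE ?addr_ge0 ?fnorm_ge0 //.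
rewrite sqr_fnorm !innerE (innerC y x) -!sqr_fnorm.
have := inner_le x y; nra.
Qed.

Lemma fnorm_sum (I : Type) (s : seq I) (F : I -> 'rV[R]_d) :
  fnorm (\sum_(i <- s) F i) <= \sum_(i <- s) fnorm (F i).
Proof.
elim: s => [|i s IH]; first by rewrite !big_nil fnorm0.
by rewrite !big_cons (le_trans (fnormD _ _)) // lerD2l.
Qed.

Lemma sqr_fnormD x y : fnorm (x + y) ^+ 2 = fnorm x ^+ 2 + 2 * inner x y + fnorm y ^+ 2.
Proof. by rewrite !sqr_fnorm !innerE (innerC y x); ring. Qed.

Lemma sqr_fnormD_le x y : fnorm (x + y) ^+ 2 <= 2 * fnorm x ^+ 2 + 2 * fnorm y ^+ 2.
Proof.
have := sqr_ge0 (fnorm (x - y)).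
rewrite !sqr_fnorm !innerE (innerC y x); lra.
Qed.

Lemma inner2_le x y : 2 * inner x y <= fnorm x ^+ 2 + fnorm y ^+ 2.
Proof.
have := sqr_ge0 (fnorm (x - y)).
rewrite !sqr_fnorm !innerE (innerC y x); lra.
Qed.

Lemma sqr_minB_le (u v c : R) : (Num.min u c - Num.min v c) ^+ 2 <= (u - v) ^+ 2.
Proof.
have le_sqr (a b : R) : 0 <= a <= b -> a ^+ 2 <= b ^+ 2.
  by case/andP=> a0 ab; rewrite ler_pXn2r // nnegrE // (le_trans a0).
case: (leP u c) => hu; case: (leP v c) => hv //.
- by rewrite -sqrrN -[leRHS]sqrrN le_sqr; lra.
- by rewrite le_sqr; lra.
- by rewrite subrr expr0n sqr_ge0.
Qed.

Section projection.
Context (alpha h : R).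
Let c := h `^ (- alpha).

Let a x := Num.min 1 (c / fnorm x).

Let c_ge0 : 0 <= c. Proof. exact: powR_ge0. Qed.

Let a_ge0 x : 0 <= a x.
Proof. by rewrite le_min ler01 divr_ge0 ?fnorm_ge0. Qed.

Let a_fnorm x : a x * fnorm x = Num.min (fnorm x) c.
Proof.
have [x0|nx] := eqVneq (fnorm x) 0; first by rewrite x0 mulr0 min_l.
by rewrite /a minr_pMl ?fnorm_ge0 // mul1r divfK.
Qed.

Lemma fnorm_proj x : fnorm (Defs.proj alpha h x) = Num.min (fnorm x) c.
Proof. by rewrite /Defs.proj fnormZ ger0_norm ?a_ge0 // a_fnorm. Qed.

Lemma proj0 : Defs.proj alpha h (0 : 'rV[R]_d) = 0.
Proof. by rewrite /Defs.proj scaler0. Qed.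

(** The radial projection onto a centered ball is nonexpansive. *)
Lemma proj_lipschitz x y :
  fnorm (Defs.proj alpha h x - Defs.proj alpha h y) <= fnorm (x - y).
Proof.
rewrite -(@ler_pXn2r _ 2) ?nnegrE ?fnorm_ge0 //.
(* With p, q the two radial factors, |x - y|^2 - |p x - q y|^2 is at least
   (|x| - |y|)^2 - (p |x| - q |y|)^2, and p |x| is the minimum of |x| and the
   radius. *)
rewrite /Defs.proj -/c -/(a x) -/(a y) !sqr_fnorm !innerE (innerC y x) -!sqr_fnorm.
have : (a x * fnorm x - a y * fnorm y) ^+ 2 <= (fnorm x - fnorm y) ^+ 2.
  by rewrite !a_fnorm sqr_minB_le.
have : a x <= 1 by rewrite ge_min lexx.
have : a y <= 1 by rewrite ge_min lexx.
have := inner_le x y; have := a_ge0 x; have := a_ge0 y.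
set p := a x; set q := a y => q0 p0 cs q1 p1 H.
have : 0 <= (1 - p * q) * (fnorm x * fnorm y - inner x y).
  by rewrite mulr_ge0 ?subr_ge0 // mulr_ile1.
nra.
Qed.

Lemma fnorm_projB_le x : fnorm (x - Defs.proj alpha h x) <= fnorm x.
Proof.
rewrite /Defs.proj -/c -/(a x) -[X in X - _]scale1r -scalerBl fnormZ.
rewrite ler_piMl ?fnorm_ge0 // ger0_norm ?subr_ge0 ?ge_min ?lexx //.
by rewrite lerBlDr lerDl.
Qed.

Lemma projB_eq0 x : fnorm x <= c -> x - Defs.proj alpha h x = 0.
Proof.
move=> xc; rewrite /Defs.proj -/c -/(a x).
have [x0|nx] := eqVneq (fnorm x) 0; first by rewrite (fnorm_eq0 x0) scaler0 subrr.
suff -> : a x = 1 by rewrite scale1r subrr.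
by rewrite /a min_l // ler_pdivlMr ?mul1r // lt0r nx fnorm_ge0.
Qed.

End projection.

End euclidean.

(** * Estimates for given values of the stochastic integrals *)

Section finite_sums.
Context (R : realType) (m : nat).
Implicit Types (x : 'I_m -> R).

Lemma sqr_sum_le x : (\sum_i x i) ^+ 2 <= m%:R * \sum_i x i ^+ 2.
Proof.
have := inner_le (\row_i x i) (const_mx 1).
have := inner_le (- \row_i x i) (const_mx 1).
rewrite innerNl fnormN.
have -> : inner (\row_i x i) (const_mx 1) = \sum_i x i.
  by apply: eq_bigr => i _; rewrite !mxE mulr1.
have -> : m%:R = fnorm (const_mx 1 : 'rV[R]_m) ^+ 2.
  rewrite sqr_fnorm /inner (eq_bigr (fun=> 1)) => [|i _]; last by rewrite !mxE mulr1.
  by rewrite sumr_const card_ord.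
have -> : \sum_i x i ^+ 2 = fnorm (\row_i x i) ^+ 2.
  by rewrite sqr_fnorm; apply: eq_bigr => i _; rewrite !mxE expr2.
rewrite -exprMn mulrC => h1 h2.
rewrite -ler_sqrt ?sqr_ge0 // !sqrtr_sqr [leRHS]ger0_norm ?mulr_ge0 ?fnorm_ge0 //.
by rewrite ler_norml; lra.
Qed.

Lemma sqr_sum_norm_le x : (\sum_i `|x i|) ^+ 2 <= m%:R * \sum_i x i ^+ 2.
Proof.
apply: le_trans (sqr_sum_le _) _; rewrite ler_wpM2l //.
by apply: ler_sum => i _; rewrite real_normK ?num_real.
Qed.

Lemma sqr_sum2_norm_le (J : 'I_m -> 'I_m -> R) :
  (\sum_i \sum_k `|J i k|) ^+ 2 <= m%:R ^+ 2 * \sum_i \sum_k J i k ^+ 2.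
Proof.
apply: le_trans (sqr_sum_le _) _; rewrite expr2 -mulrA ler_wpM2l // mulr_sumr.
by apply: ler_sum => i _; exact: sqr_sum_norm_le.
Qed.

Lemma exprD1_le (n : nat) (b : R) : 0 <= b -> (1 + b) ^+ n <= 2 ^+ n * (1 + b ^+ n).
Proof.
move=> b0; case: (leP b 1) => b1.
  apply: (@le_trans _ _ (2 ^+ n)); last by rewrite ler_peMr ?exprn_ge0 // lerDl exprn_ge0.
  by rewrite lerXn2r ?nnegrE //; lra.
apply: (@le_trans _ _ (2 ^+ n * b ^+ n)).
  by rewrite -exprMn lerXn2r ?nnegrE //; lra.
by rewrite ler_wpM2l ?exprn_ge0 // lerDr.
Qed.

Lemma exprD1_sum_le (n : nat) x :
  (1 + \sum_i `|x i|) ^+ (2 * n) <= m.+1%:R ^+ (2 * n) * (1 + \sum_i x i ^+ (2 * n)).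
Proof.
pose M := \big[Num.max/1]_i `|x i|.
have M1 : 1 <= M by apply: bigmax_ge_id.
apply: (@le_trans _ _ ((m.+1%:R * M) ^+ (2 * n))).
  rewrite lerXn2r ?nnegrE ?addr_ge0 ?sumr_ge0 // ?mulr_ge0 ?(le_trans ler01 M1) //.
  rewrite -natr1 mulrDl mul1r addrC lerD //.
  rewrite -[m in m%:R]card_ord -sum1_card natr_sum mulr_suml; apply: ler_sum => i _.
  by rewrite mul1r /M; exact: le_bigmax.
rewrite exprMn ler_wpM2l ?exprn_ge0 //.
have nn i : 0 <= x i ^+ (2 * n) by rewrite exprM exprn_ge0 // sqr_ge0.
apply: (big_ind (fun y => y ^+ (2 * n) <= 1 + \sum_i x i ^+ (2 * n))).
- by rewrite expr1n lerDl sumr_ge0.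
- by move=> u v Hu Hv; case: (leP u v).
- move=> i _; rewrite exprM real_normK ?num_real // -exprM (bigD1 i) //=.
  by rewrite addrCA lerDl addr_ge0 // sumr_ge0.
Qed.

End finite_sums.

(** The arithmetic that collects all coefficients into a single one. *)
Lemma coefficient_bound (R : realFieldType) (a b K Y p q r u v w : R) :
  0 < a -> 0 < b -> 1 <= K -> 3 * a <= K -> b <= K -> 0 <= Y -> 0 <= p ->
  0 <= q -> q <= r -> u <= 2 * K ^+ 2 * Y -> v <= 2 * K ^+ 2 * Y ->
  2 * w <= Y + r ->
  2 * a * u + 6 * a * v + 36 * a ^+ 2 * u + 2 * b * w + 3 * b ^+ 2 * p +
    3 * b ^+ 2 * q <= 20 * K ^+ 4 * (Y + p + r).
Proof.
move=> a0 b0 K1 aK bK Y0 p0 q0 qr hu hv hw.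
have K0 : 0 <= K by lra.
have K2 : 1 <= K ^+ 2 by rewrite expr_ge1.
have K20 : 0 <= K ^+ 2 by lra.
have a2 : 9 * a ^+ 2 <= K ^+ 2.
  have -> : 9 * a ^+ 2 = (3 * a) ^+ 2 by ring.
  by rewrite lerXn2r ?nnegrE // mulr_ge0 // ltW.
have b2 : b ^+ 2 <= K ^+ 2 by rewrite lerXn2r ?nnegrE // ltW.
have K4E : K ^+ 4 = K ^+ 2 * K ^+ 2 by ring.
have K24 : K ^+ 2 <= K ^+ 4 by rewrite K4E ler_peMr.
have K12 : K <= K ^+ 2 by rewrite expr2 ler_peMr.
have K14 : K <= K ^+ 4 by exact: le_trans K24.
have K4 : 0 <= K ^+ 4 by rewrite exprn_ge0.
have KY : 0 <= K ^+ 2 * Y by rewrite mulr_ge0.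
have t1 : 2 * a * u <= 2 * K ^+ 4 * Y.
  apply: (@le_trans _ _ (2 * a * (2 * K ^+ 2 * Y))).
    by rewrite ler_wpM2l // mulr_ge0 // ltW.
  have -> : 2 * a * (2 * K ^+ 2 * Y) = (4 * a) * (K ^+ 2 * Y) by ring.
  have -> : 2 * K ^+ 4 * Y = (2 * K ^+ 2) * (K ^+ 2 * Y) by ring.
  by rewrite ler_wpM2r //; lra.
have t2 : 6 * a * v <= 4 * K ^+ 4 * Y.
  apply: (@le_trans _ _ (6 * a * (2 * K ^+ 2 * Y))).
    by rewrite ler_wpM2l // mulr_ge0 // ltW.
  have -> : 6 * a * (2 * K ^+ 2 * Y) = (12 * a) * (K ^+ 2 * Y) by ring.
  have -> : 4 * K ^+ 4 * Y = (4 * K ^+ 2) * (K ^+ 2 * Y) by ring.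
  by rewrite ler_wpM2r //; lra.
have t3 : 36 * a ^+ 2 * u <= 8 * K ^+ 4 * Y.
  apply: (@le_trans _ _ (36 * a ^+ 2 * (2 * K ^+ 2 * Y))).
    by rewrite ler_wpM2l // mulr_ge0 // sqr_ge0.
  have -> : 36 * a ^+ 2 * (2 * K ^+ 2 * Y) = 8 * (9 * a ^+ 2) * (K ^+ 2 * Y) by ring.
  have -> : 8 * K ^+ 4 * Y = 8 * K ^+ 2 * (K ^+ 2 * Y) by ring.
  by rewrite ler_wpM2r // ler_pM2l.
have r0 : 0 <= r by lra.
have t4 : 2 * b * w <= K ^+ 4 * (Y + r).
  apply: (@le_trans _ _ (b * (Y + r))).
    by rewrite mulrAC mulrC ler_pM2l.
  by rewrite ler_wpM2r ?addr_ge0 // (le_trans bK).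
have t5 : 3 * b ^+ 2 * p <= 3 * K ^+ 4 * p.
  by rewrite ler_wpM2r // ler_pM2l // (le_trans b2).
have t6 : 3 * b ^+ 2 * q <= 3 * K ^+ 4 * r.
  apply: ler_pM => //; first by rewrite mulr_ge0 // sqr_ge0.
  by rewrite ler_pM2l // (le_trans b2).
have := mulr_ge0 K4 Y0; have := mulr_ge0 K4 p0; have := mulr_ge0 K4 r0.
lra.
Qed.

Section pointwise.
Context (R : realType) (T alpha kappa Kf Kg Mf Mg : R) (d m : nat).
Context (f : R -> 'rV[R]_d -> 'rV[R]_d) (g : 'I_m -> R -> 'rV[R]_d -> 'rV[R]_d).
Context (hKf : 0 < Kf) (hkappa : 0 <= kappa) (hKg : 0 < Kg).
Context (halpha : 0 < alpha < (2 * (kappa + 1))^-1).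
Context (hf : drift_assumption T Kf kappa Mf f).
Context (hg : diffusion_assumption T Kg Mg g).
Context (h s t e : R) (hh : 0 < h <= 1) (hs : 0 <= s <= T) (ht : 0 <= t <= T).
Context (he : 0 <= e <= h).
Context (i I : 'I_m -> R) (J : 'I_m -> 'I_m -> R).
Implicit Types (x y z : 'rV[R]_d).

Let h0 : 0 < h. Proof. by case/andP: hh. Qed.
Let h1 : h <= 1. Proof. by case/andP: hh. Qed.
Let rt := Num.sqrt h.
Let rt2 : rt ^+ 2 = h. Proof. by rewrite sqr_sqrtr // ltW. Qed.
Let rt_gt0 : 0 < rt. Proof. by rewrite sqrtr_gt0. Qed.
Let rt_le1 : rt <= 1. Proof. by rewrite -sqrtr1 ler_sqrt. Qed.
Let fh := fproj alpha h f.
Let L := Kf * (1 + 2 * h `^ (- (alpha * kappa))).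

Let alpha_kappa : alpha * kappa <= 2^-1.
Proof.
have k0 : 0 < 2 * (kappa + 1) by rewrite mulr_gt0 // ltr_wpDl.
case/andP: halpha => a0; rewrite -[X in _ < X]mul1r ltr_pdivlMr //.
move=> a1; have -> : alpha * kappa = (alpha * (2 * (kappa + 1))) / 2 - alpha by field.
by lra.
Qed.

(** This is where the bound on alpha is used: 1 - alpha kappa >= 1/2. *)
Lemma h_powR_le : h * h `^ (- (alpha * kappa)) <= rt.
Proof.
rewrite -{1}(powRr1 (ltW h0)) -powRD ?(gt_eqF h0) ?implybT //.
rewrite /rt -powR12_sqrt ?(ltW h0) //; apply: (ger_powR hh) => //.
by have := alpha_kappa; lra.
Qed.

Let hL : h * L <= 3 * Kf * rt.
Proof.
have := h_powR_le; rewrite /L; have := hKf.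
have : h <= rt by rewrite -rt2 expr2 ler_piMl // ltW.
move: (h `^ _) => w; nra.
Qed.

Let L_ge0 : 0 <= L.
Proof. by rewrite mulr_ge0 ?addr_ge0 ?mulr_ge0 ?powR_ge0 // ltW. Qed.

(** On the ball of radius h^(-alpha) the drift is Lipschitz with constant of
    order h^(-alpha kappa). *)
Lemma fproj_lipschitz u x y : 0 <= u <= T -> fnorm (fh u x - fh u y) <= L * fnorm (x - y).
Proof.
move=> hu; case: hf => [lip _ _ _]; rewrite /fh /fproj.
apply: le_trans (lip _ _ _ hu) _.
rewrite ler_pM ?fnorm_ge0 ?proj_lipschitz //.
  by rewrite mulr_ge0 ?addr_ge0 ?powR_ge0 // ltW.
have b v : fnorm (Defs.proj alpha h v : 'rV[R]_d) `^ kappa <= h `^ (- (alpha * kappa)).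
  rewrite -mulNr powRrM; apply: ge0_ler_powR => //; rewrite ?nnegrE ?fnorm_ge0 ?powR_ge0 //.
  by rewrite fnorm_proj ge_min lexx orbT.
rewrite ler_pM2l // -addrA lerD2l mulr2n mulrDl mul1r lerD //; exact: b.
Qed.

(** The inner stage psi, for given values [i] of the Brownian increments over
    [s, s + e] and a given time increment [e]. *)
Definition stage y := y + e *: fh s y + \sum_(r < m) i r *: g r s y.

(** The increment Phi, for given values [i], [I] of the Brownian increments over
    [s, s + e] and [s, s + h], given values [J] of the iterated integrals, and a
    given evaluation time [t] of the drift. As in the scheme, the indices of [J]
    are swapped with respect to those of [gprod]. *)
Definition increment y := h *: fh t (stage y) + \sum_(r < m) I r *: g r s y +
  \sum_(r1 < m) \sum_(r2 < m) J r2 r1 *: gprod g r1 r2 s y.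

(** What the projection removes from a vector. *)
Definition resid x := x - Defs.proj alpha h x.

Let S := \sum_r `|i r|.
Let S_ge0 : 0 <= S. Proof. by rewrite sumr_ge0. Qed.

Lemma diff_noise_le (c : 'I_m -> R) y z :
  fnorm (\sum_(r < m) c r *: g r s y - \sum_(r < m) c r *: g r s z) <=
  Kg * (\sum_r `|c r|) * fnorm (y - z).
Proof.
case: hg => _ [_ lip _ _ _].
rewrite -sumrB (le_trans (fnorm_sum _ _)) // mulr_sumr mulr_suml.
apply: ler_sum => r _; rewrite -scalerBr fnormZ mulrAC mulrC ler_wpM2r //.
exact: lip.
Qed.

Lemma diff_gprod_le y z :
  fnorm (\sum_(r1 < m) \sum_(r2 < m) J r2 r1 *: gprod g r1 r2 s y -
         \sum_(r1 < m) \sum_(r2 < m) J r2 r1 *: gprod g r1 r2 s z) <=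
  Kg * (\sum_r1 \sum_r2 `|J r2 r1|) * fnorm (y - z).
Proof.
case: hg => _ [_ _ _ lip _].
rewrite -sumrB (le_trans (fnorm_sum _ _)) // mulr_sumr mulr_suml.
apply: ler_sum => r1 _; rewrite -sumrB (le_trans (fnorm_sum _ _)) // mulr_sumr mulr_suml.
apply: ler_sum => r2 _; rewrite -scalerBr fnormZ mulrAC mulrC ler_wpM2r //.
exact: lip.
Qed.

(** The stage moves the difference of two points by O(h^(1/2)). *)
Lemma stage_drift_le y z :
  fnorm ((y - z) - (stage y - stage z)) <= (3 * Kf * rt + Kg * S) * fnorm (y - z).
Proof.
have -> : (y - z) - (stage y - stage z) =
    - (e *: (fh s y - fh s z) +
       (\sum_(r < m) i r *: g r s y - \sum_(r < m) i r *: g r s z)).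
  rewrite /stage scalerBr.
  move: (e *: _) (e *: _) (\sum_(r < m) _) (\sum_(r < m) _) => a b c k.
  by apply/rowP => j; rewrite !mxE; ring.
rewrite fnormN (le_trans (fnormD _ _)) // mulrDl lerD ?diff_noise_le //.
case/andP: he => e0 eh; rewrite fnormZ ger0_norm //.
apply: (@le_trans _ _ (h * (L * fnorm (y - z)))).
  by rewrite ler_pM ?fnorm_ge0 // fproj_lipschitz.
by rewrite mulrA ler_wpM2r ?fnorm_ge0.
Qed.

Lemma stage_lipschitz y z :
  fnorm (stage y - stage z) <= (1 + 3 * Kf * rt + Kg * S) * fnorm (y - z).
Proof.
have -> : stage y - stage z = (y - z) - ((y - z) - (stage y - stage z)).
  by rewrite subKr.
rewrite (le_trans (fnormD _ _)) // fnormN -[1 + _ + _]addrA mulrDl mul1r lerD2l.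
exact: stage_drift_le.
Qed.

Let D y z := h *: (fh t (stage y) - fh t (stage z)).

Lemma diff_drift_le y z :
  fnorm (D y z) <= 3 * Kf * rt * (1 + 3 * Kf * rt + Kg * S) * fnorm (y - z).
Proof.
rewrite fnormZ ger0_norm ?(ltW h0) ?(ltW hKf) ?(ltW hKg) ?(ltW rt_gt0) //.
have := fproj_lipschitz (stage y) (stage z) ht; have := stage_lipschitz y z.
have := hL; have := fnorm_ge0 (stage y - stage z); have := L_ge0.
move: (fnorm (stage _ - _)) => p l0 p0 hl hp hq.
apply: (@le_trans _ _ (h * L * p)); first by rewrite -mulrA ler_pM2l.
apply: (@le_trans _ _ (3 * Kf * rt * p)); first by rewrite ler_wpM2r.
by rewrite -!mulrA; do 2 (rewrite ler_wpM2l ?(ltW h0) ?(ltW hKf) ?(ltW hKg) ?(ltW rt_gt0) //); rewrite ler_pM2l // mulrA.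
Qed.

Let incrementB y z : increment y - increment z = D y z +
  (\sum_(r < m) I r *: g r s y - \sum_(r < m) I r *: g r s z) +
  (\sum_(r1 < m) \sum_(r2 < m) J r2 r1 *: gprod g r1 r2 s y -
   \sum_(r1 < m) \sum_(r2 < m) J r2 r1 *: gprod g r1 r2 s z).
Proof.
have sub3 (u v w u' v' w' : 'rV[R]_d) :
    (u + v + w) - (u' + v' + w') = (u - u') + (v - v') + (w - w').
  by rewrite !opprD addrACA [X in X + _ = _]addrACA.
by rewrite /increment /D scalerBr; exact: sub3.
Qed.

(** The random coefficient, of expectation of order [h], that dominates all those
    appearing in the estimates. The iterated integrals are of order [h] and their
    squares of order [h^2], which makes room for the division by [h]. *)
Definition noise := h + \sum_r i r ^+ 2 + \sum_r I r ^+ 2 +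
  (\sum_r1 \sum_r2 J r1 r2 ^+ 2) / h.

Let K := 1 + 3 * Kf + Kg.

(** The numerical factor in front of [noise]. *)
Definition stab_const := 20 * K ^+ 4 * m.+1%:R ^+ 2.

Let A := \sum_r `|I r|.
Let B := \sum_r1 \sum_r2 `|J r2 r1|.
Let B_ge0 : 0 <= B. Proof. by do 2 (apply: sumr_ge0 => ? _). Qed.

Let noise_ge : h + S ^+ 2 + A ^+ 2 + B ^+ 2 / h <= m.+1%:R ^+ 2 * noise.
Proof.
have := sqr_sum_norm_le i; have := sqr_sum_norm_le I; have := sqr_sum2_norm_le J.
rewrite -/S -/A.
have -> : \sum_(i0 < m) \sum_(k < m) `|J i0 k| = B by rewrite exchange_big.
rewrite /noise !mulrDr mulrA -[X in _ -> X <= _]mul1r.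
set u := \sum_r i r ^+ 2; set v := \sum_r I r ^+ 2.
set w := \sum_r1 \sum_r2 J r1 r2 ^+ 2 => hB hA hS.
have u0 : 0 <= u by apply: sumr_ge0 => ? _; exact: sqr_ge0.
have v0 : 0 <= v by apply: sumr_ge0 => ? _; exact: sqr_ge0.
have w0 : 0 <= w by do 2 (apply: sumr_ge0 => ? _); exact: sqr_ge0.
have m0 : 0 <= m%:R :> R by [].
have mS : m.+1%:R = 1 + m%:R :> R by rewrite -natr1 addrC.
rewrite mul1r mS; set n := m%:R in hB hA hS m0 *.
have M1 : 1 <= (1 + n) ^+ 2 by nra.
have Mn : n <= (1 + n) ^+ 2 by nra.
have Mn2 : n ^+ 2 <= (1 + n) ^+ 2 by nra.
rewrite !lerD //.
- by rewrite ler_peMl ?(ltW h0).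
- by apply: (le_trans hS); rewrite ler_wpM2r.
- by apply: (le_trans hA); rewrite ler_wpM2r.
- rewrite ler_wpM2r ?invr_ge0 ?(ltW h0) //.
  by apply: (le_trans hB); rewrite ler_wpM2r.
Qed.

Let X := h + S ^+ 2 + A ^+ 2 + B ^+ 2 / h.
Let V := 1 + 3 * Kf * rt + Kg * S.

Let B2_le : B ^+ 2 <= B ^+ 2 / h.
Proof. by rewrite ler_peMr ?sqr_ge0 // invf_ge1. Qed.

(* Young's inequality, used for the cross term of D with the iterated integrals. *)
Let B_le : 2 * B <= h + B ^+ 2 / h.
Proof.
have -> : h + B ^+ 2 / h = 2 * B + (h - B) ^+ 2 / h.
  by field; rewrite gt_eqF.
by rewrite lerDl divr_ge0 ?sqr_ge0 // ltW.
Qed.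

Let K_ge1 : 1 <= K.
Proof. by rewrite /K -addrA lerDl addr_ge0 // ?mulr_ge0 // ltW. Qed.

Let K_ge0 : 0 <= K. Proof. exact: le_trans ler01 K_ge1. Qed.

Let KS_ge0 : 0 <= K * (1 + S).
Proof. by rewrite mulr_ge0 ?K_ge0 // addr_ge0. Qed.

Let V_le : V <= K * (1 + S).
Proof.
have : 3 * Kf * rt <= 3 * Kf by rewrite ler_piMr ?mulr_ge0 // ltW.
rewrite /V /K; have := hKf; have := hKg; have := S_ge0; nra.
Qed.

Let V_ge0 : 0 <= V.
Proof. by rewrite /V !addr_ge0 ?mulr_ge0 // ltW. Qed.

Let hV2_le : h * V ^+ 2 <= 2 * K ^+ 2 * (h + S ^+ 2).
Proof.
apply: (@le_trans _ _ (h * (K * (1 + S)) ^+ 2)).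
  by rewrite ler_pM2l // ler_pXn2r ?nnegrE //.
have -> : h * (K * (1 + S)) ^+ 2 = K ^+ 2 * (h * (1 + S) ^+ 2) by ring.
have -> : 2 * K ^+ 2 * (h + S ^+ 2) = K ^+ 2 * (2 * (h + S ^+ 2)) by ring.
rewrite ler_wpM2l ?sqr_ge0 //.
have := sqr_ge0 (1 - S); have : h * S ^+ 2 <= S ^+ 2 by rewrite ler_piMl ?sqr_ge0.
have := h0; move: (S) (S_ge0) => v v0 p0 p1 p2; nra.
Qed.

Let rtS : rt * S <= (h + S ^+ 2) / 2.
Proof. by have := sqr_ge0 (rt - S); rewrite -rt2; nra. Qed.

Let mid_le : rt * (3 * Kf * rt + Kg * S) * V <= 2 * K ^+ 2 * (h + S ^+ 2).
Proof.
apply: (@le_trans _ _ (rt * (K * (rt + S)) * (K * (1 + S)))).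
  rewrite ler_pM ?mulr_ge0 ?addr_ge0 ?mulr_ge0 ?(ltW rt_gt0) ?(ltW hKf) ?(ltW hKg) //.
  rewrite ler_pM2l // /K; have := rt_gt0; have := hKf; have := hKg; have := S_ge0; nra.
have -> : rt * (K * (rt + S)) * (K * (1 + S)) =
   K ^+ 2 * (rt ^+ 2 + rt ^+ 2 * S + rt * S + rt * S ^+ 2) by ring.
have -> : 2 * K ^+ 2 * (h + S ^+ 2) = K ^+ 2 * (2 * (h + S ^+ 2)) by ring.
rewrite rt2 ler_wpM2l ?sqr_ge0 //.
have p1 : h * S <= rt * S by rewrite ler_wpM2r // -rt2 expr2 ler_piMl // ltW.
have p2 : rt * S ^+ 2 <= S ^+ 2 by rewrite ler_piMl ?sqr_ge0.
by have := rtS; lra.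
Qed.

Let coef_le :
  2 * Kf * (h * V ^+ 2) + 6 * Kf * (rt * (3 * Kf * rt + Kg * S) * V) +
  36 * Kf ^+ 2 * (h * V ^+ 2) + 2 * Kg * B + 3 * Kg ^+ 2 * A ^+ 2 + 3 * Kg ^+ 2 * B ^+ 2
  <= 20 * K ^+ 4 * X.
Proof.
have e1 : 3 * Kf <= K by rewrite /K [1 + _]addrC -addrA lerDl addr_ge0 // (ltW hKg).
have e2 : Kg <= K by rewrite /K lerDr addr_ge0 // mulr_ge0 // (ltW hKf).
have e3 : 0 <= h + S ^+ 2 by rewrite addr_ge0 ?sqr_ge0 // (ltW h0).
have e4 : 2 * B <= h + S ^+ 2 + B ^+ 2 / h.
  by apply: (le_trans B_le); rewrite lerD2r lerDl sqr_ge0.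
exact: (coefficient_bound hKf hKg K_ge1 e1 e2 e3 (sqr_ge0 A) (sqr_ge0 B) B2_le
  hV2_le mid_le e4).
Qed.

Let diff_sqr_le y z : fnorm (D y z) ^+ 2 <= 9 * Kf ^+ 2 * (h * V ^+ 2) * fnorm (y - z) ^+ 2.
Proof.
have -> : 9 * Kf ^+ 2 * (h * V ^+ 2) * fnorm (y - z) ^+ 2 =
   (3 * Kf * rt * V * fnorm (y - z)) ^+ 2 by rewrite -rt2; ring.
rewrite lerXn2r ?nnegrE ?fnorm_ge0 ?mulr_ge0 ?fnorm_ge0 ?(ltW hKf) ?(ltW rt_gt0) //.
exact: diff_drift_le.
Qed.

Let sqr_fnormD3_le x y z :
  fnorm (x + y + z) ^+ 2 <= 3 * fnorm x ^+ 2 + 3 * fnorm y ^+ 2 + 3 * fnorm z ^+ 2.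
Proof.
rewrite !sqr_fnorm !innerE (innerC y x) (innerC z x) (innerC z y).
have := inner2_le x y; have := inner2_le x z; have := inner2_le y z.
rewrite !sqr_fnorm; lra.
Qed.

Let incr_diff_le y z : fnorm (increment y - increment z) ^+ 2 <=
  (27 * Kf ^+ 2 * (h * V ^+ 2) + 3 * Kg ^+ 2 * A ^+ 2 + 3 * Kg ^+ 2 * B ^+ 2) *
  fnorm (y - z) ^+ 2.
Proof.
rewrite incrementB; apply: (le_trans (sqr_fnormD3_le _ _ _)).
have e1 : fnorm (\sum_(r < m) I r *: g r s y - \sum_(r < m) I r *: g r s z) ^+ 2
   <= (Kg * A * fnorm (y - z)) ^+ 2.
  rewrite lerXn2r ?nnegrE ?fnorm_ge0 ?mulr_ge0 ?sumr_ge0 ?fnorm_ge0 ?(ltW hKg) //.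
  exact: diff_noise_le.
have e2 : fnorm (\sum_(r1 < m) \sum_(r2 < m) J r2 r1 *: gprod g r1 r2 s y -
   \sum_(r1 < m) \sum_(r2 < m) J r2 r1 *: gprod g r1 r2 s z) ^+ 2
   <= (Kg * B * fnorm (y - z)) ^+ 2.
  rewrite lerXn2r ?nnegrE ?fnorm_ge0 ?mulr_ge0 ?fnorm_ge0 ?(ltW hKg) //.
  exact: diff_gprod_le.
move: e1 e2 (diff_sqr_le y z).
move: (fnorm (D y z)) (fnorm (_ - _)) (fnorm (_ - _)) (fnorm (y - z)) V A B.
by move=> u v w k V' A' B' e1 e2 e3; lra.
Qed.

Let coef_ge0 : 0 <= 2 * Kf * (h * V ^+ 2) + 6 * Kf * (rt * (3 * Kf * rt + Kg * S) * V) +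
  9 * Kf ^+ 2 * (h * V ^+ 2) + 2 * Kg * B.
Proof.
by rewrite !addr_ge0 ?mulr_ge0 ?addr_ge0 ?mulr_ge0 ?exprn_ge0 ?(ltW hKf) ?(ltW hKg)
  ?(ltW rt_gt0) ?(ltW h0).
Qed.

Let to_noise c y z : c <= 20 * K ^+ 4 * X ->
  c * fnorm (y - z) ^+ 2 <= stab_const * (fnorm (y - z) ^+ 2 * noise).
Proof.
move=> cX; rewrite mulrC mulrCA ler_wpM2l ?sqr_ge0 //.
apply: (le_trans cX); rewrite /stab_const -[leRHS]mulrA ler_wpM2l ?noise_ge //.
by rewrite mulr_ge0 // exprn_even_ge0.
Qed.

Lemma increment_diff_le y z :
  fnorm (increment y - increment z) ^+ 2 <= stab_const * (fnorm (y - z) ^+ 2 * noise).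
Proof.
apply: (le_trans (incr_diff_le y z)); apply: to_noise.
by have := coef_le; have := coef_ge0; lra.
Qed.

(** The one-step stability estimate for given values of the stochastic
    integrals. The one-sided Lipschitz condition applies to the difference of
    the projected stages; replacing it by [y - z] costs [stage_drift_le] and
    the two residuals. *)
Lemma increment_stability y z :
  fnorm (y - z + increment y - increment z) ^+ 2 <=
  fnorm (y - z) ^+ 2 +
  \sum_r (2 * inner (y - z) (g r s y - g r s z)) * I r +
  stab_const * (fnorm (y - z) ^+ 2 * noise) +
  (2 * fnorm (resid (stage y)) ^+ 2 + 2 * fnorm (resid (stage z)) ^+ 2).
Proof.
have -> : y - z + increment y - increment z = (y - z) + (increment y - increment z).
  by rewrite -[LHS]addrA.
have := incr_diff_le y z; set E := increment y - increment z => hE.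
rewrite sqr_fnormD.
have EE : inner (y - z) E = inner (y - z) (D y z) +
    \sum_r inner (y - z) (g r s y - g r s z) * I r +
    inner (y - z) (\sum_(r1 < m) \sum_(r2 < m) J r2 r1 *: gprod g r1 r2 s y -
      \sum_(r1 < m) \sum_(r2 < m) J r2 r1 *: gprod g r1 r2 s z).
  rewrite /E incrementB (innerDr _ (D y z + _)) (innerDr _ (D y z)); congr (_ + _ + _).
  rewrite -sumrB inner_sumr; apply: eq_bigr => r _.
  by rewrite -scalerBr innerZr mulrC.
have hG2 := le_trans (inner_le (y - z) _)
  (ler_wpM2l (fnorm_ge0 (y - z)) (diff_gprod_le y z)).
move: hG2; rewrite EE -/B; set G2 := inner (y - z) (_ - _) => hG2.
(* The decomposition of y - z along which the drift term is estimated. *)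
have dD : y - z = (Defs.proj alpha h (stage y) - Defs.proj alpha h (stage z)) +
    ((y - z) - (stage y - stage z)) + (resid (stage y) - resid (stage z)).
  rewrite /resid; move: (stage y) (stage z) (Defs.proj _ _ _) (Defs.proj _ _ _).
  by move=> a b c k; apply/rowP => j; rewrite !mxE; ring.
have h1D : 2 * inner (Defs.proj alpha h (stage y) - Defs.proj alpha h (stage z)) (D y z)
    <= 2 * Kf * (h * V ^+ 2) * fnorm (y - z) ^+ 2.
  case: hf => _ _ _ osl; rewrite /D innerZr.
  apply: (@le_trans _ _ (2 * (h * (Kf * (V * fnorm (y - z)) ^+ 2)))); last first.
    by rewrite le_eqVlt; apply/orP; left; apply/eqP; ring.
  rewrite ler_pM2l // ler_pM2l //; apply: (le_trans (osl _ _ _ ht)).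
  rewrite ler_pM2l // lerXn2r ?nnegrE ?fnorm_ge0 ?mulr_ge0 ?fnorm_ge0 //.
  exact: le_trans (proj_lipschitz _ _ _ _) (stage_lipschitz _ _).
have h2D : 2 * inner ((y - z) - (stage y - stage z)) (D y z) <=
    6 * Kf * (rt * (3 * Kf * rt + Kg * S) * V) * fnorm (y - z) ^+ 2.
  apply: (@le_trans _ _ (2 * (((3 * Kf * rt + Kg * S) * fnorm (y - z)) *
      (3 * Kf * rt * V * fnorm (y - z))))); last first.
    by rewrite le_eqVlt; apply/orP; left; apply/eqP; ring.
  rewrite ler_pM2l //; apply: (le_trans (inner_le _ _)).
  by apply: ler_pM; rewrite ?fnorm_ge0 ?stage_drift_le ?diff_drift_le.
have h3D : 2 * inner (resid (stage y) - resid (stage z)) (D y z) <=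
    2 * fnorm (resid (stage y)) ^+ 2 + 2 * fnorm (resid (stage z)) ^+ 2 +
    9 * Kf ^+ 2 * (h * V ^+ 2) * fnorm (y - z) ^+ 2.
  apply: (le_trans (inner2_le _ _)); rewrite lerD ?diff_sqr_le //.
  by rewrite (le_trans (sqr_fnormD_le _ _)) // fnormN.
have hD : 2 * inner (y - z) (D y z) <=
    (2 * Kf * (h * V ^+ 2) + 6 * Kf * (rt * (3 * Kf * rt + Kg * S) * V) +
     9 * Kf ^+ 2 * (h * V ^+ 2)) * fnorm (y - z) ^+ 2 +
    (2 * fnorm (resid (stage y)) ^+ 2 + 2 * fnorm (resid (stage z)) ^+ 2).
  have -> : inner (y - z) (D y z) =
      inner (Defs.proj alpha h (stage y) - Defs.proj alpha h (stage z)) (D y z) +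
      inner ((y - z) - (stage y - stage z)) (D y z) +
      inner (resid (stage y) - resid (stage z)) (D y z) by rewrite -!innerDl -dD.
  move: h1D h2D h3D; move: (inner _ _) (inner _ _) (inner _ _) => i1 i2 i3; lra.
have -> : \sum_r (2 * inner (y - z) (g r s y - g r s z)) * I r =
    2 * \sum_r inner (y - z) (g r s y - g r s z) * I r.
  by rewrite mulr_sumr; apply: eq_bigr => r _; rewrite mulrA.
have := to_noise y z coef_le.
set c := 36 * _ ^+ 2 * _; have cE : c = 4 * (9 * Kf ^+ 2 * (h * V ^+ 2)).
  by rewrite /c; ring.
move: hE; have -> : 27 * Kf ^+ 2 * (h * V ^+ 2) = 3 * (9 * Kf ^+ 2 * (h * V ^+ 2)) by ring.
rewrite cE !mulrDl.
lra.
Qed.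

(** Outside the ball of radius h^(-alpha) one has |x| h^alpha > 1, so that the
    residual is small as soon as a high moment is available. *)
Lemma sqr_resid_le (p : nat) x : 3 <= alpha * (2 * p)%:R ->
  fnorm (resid x) ^+ 2 <= h ^+ 3 * fnorm x ^+ (2 * p.+1).
Proof.
move=> hp; have [xc|xc] := leP (fnorm x) (h `^ (- alpha)).
  by rewrite /resid projB_eq0 // fnorm0 expr0n /= mulr_ge0 ?exprn_ge0 ?fnorm_ge0 ?(ltW h0).
apply: (@le_trans _ _ (fnorm x ^+ 2)).
  by rewrite lerXn2r ?nnegrE ?fnorm_ge0 // fnorm_projB_le.
rewrite mulnS exprD mulrCA ler_peMr ?sqr_ge0 //.
have a1 : 1 <= h `^ alpha * fnorm x.
  rewrite mulrC -ler_pdivrMr ?powR_gt0 // mul1r -powRN; exact: ltW.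
apply: (@le_trans _ _ ((h `^ alpha * fnorm x) ^+ (2 * p))); first by rewrite exprn_ege1.
rewrite exprMn ler_wpM2r ?exprn_ge0 ?fnorm_ge0 //.
rewrite -(powR_mulrn (2 * p) (powR_ge0 h alpha)) -powRrM -(powR_mulrn 3 (ltW h0)).
exact: (ger_powR hh).
Qed.

(** The constant of linear growth of the stage. The bounds on the coefficients at
    the origin enter through their absolute values because [Mg] may be negative
    when there is no Brownian motion. *)
Definition growth_const := 1 + 3 * Kf + Kg + `|Mf| + `|Mg|.

Lemma stage_growth y :
  fnorm (stage y) <= growth_const * (1 + fnorm y) * (1 + S).
Proof.
have fs0 : fnorm (fh s 0) <= `|Mf|.
  case: hf => _ M _ _; rewrite /fh /fproj proj0.
  exact: le_trans (M _ hs) (ler_norm _).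
have gs r : fnorm (g r s y) <= `|Mg| + Kg * fnorm y.
  case: hg => _ [M lip _ _ _].
  rewrite -[g r s y](subrK (g r s 0)) addrC (le_trans (fnormD _ _)) // lerD //.
    exact: le_trans (M _ _ hs) (ler_norm _).
  by rewrite (le_trans (lip _ _ _ _ hs)) // subr0.
have e1 : fnorm (e *: fh s y) <= `|Mf| + 3 * Kf * fnorm y.
  case/andP: he => e0 eh; rewrite fnormZ ger0_norm //.
  have fy : fnorm (fh s y) <= `|Mf| + L * fnorm y.
    rewrite -[fh s y](subrK (fh s 0)) addrC (le_trans (fnormD _ _)) // lerD //.
    by rewrite (le_trans (fproj_lipschitz _ _ hs)) // subr0.
  apply: (@le_trans _ _ (h * (`|Mf| + L * fnorm y))); first by rewrite ler_pM ?fnorm_ge0.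
  rewrite mulrDr lerD ?ler_piMl // mulrA ler_wpM2r ?fnorm_ge0 //.
  by rewrite (le_trans hL) // ler_piMr // mulr_ge0 // (ltW hKf).
have e2 : fnorm (\sum_(r < m) i r *: g r s y) <= S * (`|Mg| + Kg * fnorm y).
  rewrite (le_trans (fnorm_sum _ _)) // mulr_suml; apply: ler_sum => r _.
  by rewrite fnormZ ler_wpM2l.
apply: (@le_trans _ _ (fnorm y + (`|Mf| + 3 * Kf * fnorm y) + S * (`|Mg| + Kg * fnorm y))).
  rewrite (le_trans (fnormD _ _)) // lerD // (le_trans (fnormD _ _)) // lerD2l //.
have := fnorm_ge0 y; have := S_ge0; have := hKf; have := hKg.
have := normr_ge0 Mf; have := normr_ge0 Mg; rewrite /growth_const.
move: (fnorm y) S `|Mf| `|Mg| => a b p q q0 p0 kg0 kf0 b0 a0.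
have -> : (1 + 3 * Kf + Kg + p + q) * (1 + a) * (1 + b) =
   a + (p + 3 * Kf * a) + b * (q + Kg * a) +
  (1 + b + a * b + 3 * Kf * (1 + b + a * b) + Kg * (1 + a + b) + p * (a + b + a * b) +
   q * (1 + a + a * b)) by ring.
by rewrite lerDl !addr_ge0 ?mulr_ge0 ?addr_ge0 ?mulr_ge0 ?(ltW kf0) ?(ltW kg0).
Qed.

(** The constant in the bound of the residual of the stage by moments of order
    [2 n]. *)
Definition resid_const (n : nat) : R := (growth_const * 2 * m.+1%:R) ^+ (2 * n).

Lemma resid_stage_le (p : nat) y : 3 <= alpha * (2 * p)%:R ->
  fnorm (resid (stage y)) ^+ 2 <= resid_const p.+1 * h ^+ 3 *
   ((1 + fnorm y ^+ (2 * p.+1)) * (1 + \sum_r i r ^+ (2 * p.+1))).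
Proof.
move=> hp; apply: (le_trans (sqr_resid_le _ hp)).
rewrite [resid_const _ * _]mulrC -[leRHS]mulrA ler_pM2l ?exprn_gt0 //.
have G0 : 0 <= growth_const.
  by rewrite !addr_ge0 ?mulr_ge0 ?(ltW hKf) ?(ltW hKg).
apply: (@le_trans _ _ ((growth_const * (1 + fnorm y) * (1 + S)) ^+ (2 * p.+1))).
  rewrite lerXn2r ?stage_growth // nnegrE ?fnorm_ge0 //.
  by rewrite mulr_ge0 ?addr_ge0 // mulr_ge0 // addr_ge0 // fnorm_ge0.
set N := (2 * p.+1)%N.
apply: (@le_trans _ _ (growth_const ^+ N *
    ((2 ^+ N * (1 + fnorm y ^+ N)) * (m.+1%:R ^+ N * (1 + \sum_r i r ^+ N))))).
  rewrite !exprMn -mulrA ler_wpM2l ?exprn_ge0 //; apply: ler_pM.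
  - by rewrite exprn_ge0 // addr_ge0 // fnorm_ge0.
  - by rewrite exprn_ge0 // addr_ge0.
  - exact/exprD1_le/fnorm_ge0.
  - exact: exprD1_sum_le.
rewrite /resid_const -/N !exprMn.
by rewrite le_eqVlt; apply/orP; left; apply/eqP; ring.
Qed.

End pointwise.

(** * Lower integrals, Gaussian moments and independent increments *)

Section lower_integral.
Local Open Scope ereal_scope.
Context (R : realType).
Import HBNNSimple.

(** The integral of a nonnegative function that need not be measurable is a
    lower integral, hence monotone. *)
Lemma ge0_le_lower_integral d (T : measurableType d) (mu : {measure set T -> \bar R})
    (D : set T) (f g : T -> \bar R) :
  (forall x, D x -> 0 <= f x) -> (forall x, D x -> f x <= g x) ->
  \int[mu]_(x in D) f x <= \int[mu]_(x in D) g x.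
Proof.
move=> f0 fg; have g0 x : D x -> 0 <= g x by move=> Dx; apply: le_trans (fg _ Dx); exact: f0.
rewrite !ge0_integralE //; apply: le_ereal_sup => _ [h hf <-] /=.
exists h => // x; apply: (le_trans (hf x)); rewrite !patchE.
by case: ifPn => // /set_mem; exact: fg.
Qed.

(** The half of Tonelli's theorem that needs no measurability of [f]. *)
Lemma lower_integral_prod_le d1 d2 (T1 : measurableType d1) (T2 : measurableType d2)
    (m1 : {sigma_finite_measure set T1 -> \bar R})
    (m2 : {sigma_finite_measure set T2 -> \bar R})
    (f : T1 * T2 -> \bar R) (F : T2 -> \bar R) :
  (forall z, 0 <= f z) -> measurable_fun setT F ->
  (forall y, \int[m1]_x f (x, y) <= F y) ->
  \int[m1 \x m2]_z f z <= \int[m2]_y F y.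
Proof.
move=> f0 mF fF; rewrite ge0_integralTE //; apply: ge_ereal_sup => _ [h /= hf <-].
have mh : measurable_fun setT (EFin \o h) by exact/measurable_EFinP.
have h0 z : 0 <= (EFin \o h) z by rewrite lee_fin.
have -> : sintegral (m1 \x m2) h = \int[m1 \x m2]_z (h z)%:E.
  by rewrite integral_nnsfun // patch_setT.
rewrite (fubini_tonelli2 (EFin \o h)) // /fubini_G; apply: ge0_le_integral => //.
- by move=> y _; exact: integral_ge0.
- exact: measurable_fun_fubini_tonelli_G.
- move=> y _; apply: le_trans (fF y); apply: ge0_le_lower_integral => x _ /=.
    exact: h0.
  exact: hf.
Qed.

(** Integration against a measure with a density, by monotone approximation with
    simple functions. *)
Lemma ge0_integral_density d (T : measurableType d) (mu nu : {measure set T -> \bar R})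
    (p : T -> R) (f : T -> R) :
  measurable_fun setT p -> (forall x, 0 <= p x)%R ->
  (forall A, measurable A -> nu A = \int[mu]_(x in A) (p x)%:E) ->
  measurable_fun setT f -> (forall x, 0 <= f x)%R ->
  \int[nu]_x (f x)%:E = \int[mu]_x (f x * p x)%:E.
Proof.
move=> mp p0 nuE mf f0.
have mF : measurable_fun setT (EFin \o f) by exact/measurable_EFinP.
pose h := nnsfun_approx measurableT mF.
have hf x : (EFin \o (h ^~ x)) @ \oo --> (f x)%:E.
  by apply: (@cvg_nnsfun_approx _ _ _ _ _ _ mF) => // y _; rewrite lee_fin.
have ndh x : {homo (h ^~ x) : n k / (n <= k)%N >-> (n <= k)%R}.
  by move=> n k nk; exact/lefP/nd_nnsfun_approx.
have mhp n : measurable_fun setT (EFin \o (fun x => h n x * p x)%R).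
  exact/measurable_EFinP/measurable_funM.
transitivity (limn (fun n => \int[nu]_x (h n x)%:E)).
  rewrite -monotone_convergence //.
  - by apply: eq_integral => x _; apply/esym/cvg_lim => //; exact: hf.
  - by move=> n; exact/measurable_EFinP.
  - by move=> n x _; rewrite lee_fin.
  - by move=> x _ n k nk; rewrite lee_fin; exact: ndh.
transitivity (limn (fun n => \int[mu]_x (h n x * p x)%:E)); last first.
  rewrite -monotone_convergence //.
  - apply: eq_integral => x _; apply/cvg_lim => //.
    under eq_fun do rewrite EFinM.
    by rewrite EFinM; apply: cvgeZr => //; exact: hf.
  - by move=> n x _; rewrite lee_fin mulr_ge0.
  - by move=> x _ n k nk; rewrite lee_fin ler_wpM2r //; exact: ndh.
congr (limn _); apply/funext => n.
under eq_integral do rewrite fimfunE -fsumEFin //.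
under [RHS]eq_integral do rewrite fimfunE mulr_fsuml -fsumEFin //.
have mA r : measurable (h n @^-1` [set r]) by exact: measurable_sfunP.
rewrite !ge0_integral_fsum //.
- apply: eq_fsbigr => r /set_mem [x _ rE].
  have r0 : (0 <= r)%R by rewrite -rE.
  under eq_integral do rewrite EFinM.
  under [RHS]eq_integral do rewrite -mulrA EFinM.
  rewrite !ge0_integralZl //=; last 3 first.
  - by apply/measurable_EFinP/measurable_funM => //; exact: measurable_indic.
  - by move=> y _; rewrite lee_fin mulr_ge0.
  - exact/measurable_EFinP/measurable_indic.
  rewrite integral_indic // setIT nuE // integral_mkcond; congr (_ * _).
  by apply: eq_integral => y _; rewrite patchE indicE; case: ifPn; rewrite (mul1r, mul0r).
- by move=> r; apply/measurable_EFinP; do 2 apply: measurable_funM => //.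
- by move=> r x _; rewrite lee_fin mulr_ge0 // -lee_fin nnfun_muleindic_ge0.
- by move=> r; apply/measurable_EFinP; apply: measurable_funM.
- by move=> r x _; rewrite nnfun_muleindic_ge0.
Qed.

End lower_integral.

Section normal_moments.
Context (R : realType).
Notation mu := (@lebesgue_measure R).
Implicit Types (s x : R).

(** The centered normal law is symmetric. *)
Lemma normal_probN s (A : set R) : s != 0 -> measurable A ->
  normal_prob 0 s (-%R @^-1` A) = normal_prob 0 s A.
Proof.
move=> s0 mA; rewrite /normal_prob.
have mN : measurable_fun setT (-%R : measurableTypeR R -> measurableTypeR R).
  exact: oppr_measurable.
have -> : (\int[mu]_(x in A) (normal_pdf 0 s x)%:E =
    \int[pushforward mu (-%R : measurableTypeR R -> measurableTypeR R)]_(x in A) (normal_pdf 0 s x)%:E)%E.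
  by apply: eq_measure_integral => B mB _; apply/esym/lebesgue_measureN.
rewrite ge0_integral_pushforward //.
- apply: eq_integral => x _ /=; congr EFin.
  by rewrite !normal_pdfE // /normal_fun !subr0 sqrrN.
- by apply/measurable_EFinP/measurable_funTS; exact: measurable_normal_pdf.
- by move=> x _; rewrite lee_fin normal_pdf_ge0.
Qed.

Lemma expr_le_expR (n : nat) x : 0 <= x -> x ^+ n <= n`!%:R * expR x.
Proof.
case: n => [|n] x0; first by rewrite expr0 mul1r -expR0 ler_expR.
have n0 : 0 < n.+1`!%:R :> R by rewrite ltr0n fact_gt0.
rewrite mulrC -ler_pdivrMr //; apply: le_trans (expR_ge1Dxn n x0).
by rewrite lerDr.
Qed.

(** A bound for the moment of order [2 n] of the standard normal law. *)
Definition normal_moment_const (n : nat) : R := 8 ^+ n * n`!%:R * 2.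

Lemma normal_moment_const_ge0 n : 0 <= normal_moment_const n.
Proof. by rewrite /normal_moment_const !mulr_ge0 // exprn_ge0. Qed.

(** The even moments of N(0, s^2) are bounded by the polynomial growth of
    x^(2n) against the density of N(0, (2s)^2). *)
Lemma normal_moment_le s (n : nat) : 0 < s ->
  (\int[normal_prob 0 s]_x (x ^+ (2 * n))%:E <=
   (normal_moment_const n * s ^+ (2 * n))%:E)%E.
Proof.
move=> s0; have sn0 : s != 0 by rewrite gt_eqF.
have e0 x : 0 <= x ^+ (2 * n) by rewrite exprM exprn_ge0 // sqr_ge0.
rewrite (@ge0_integral_density _ _ _ mu _ (normal_pdf 0 s)) //; last 2 first.
- exact: (measurable_normal_pdf 0 s).
- by move=> x; exact: normal_pdf_ge0.
pose c := normal_moment_const n * s ^+ (2 * n).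
have c0 : 0 <= c by rewrite /c !mulr_ge0 ?exprn_ge0 // ltW.
apply: (@le_trans _ _ (\int[mu]_x (c%:E * (normal_pdf 0 (2 * s) x)%:E)%E)%E).
  apply: ge0_le_integral => //.
  - by move=> x _; rewrite lee_fin mulr_ge0 // normal_pdf_ge0.
  - apply/measurable_EFinP/measurable_funM; first exact: exprn_measurable.
    exact: measurable_normal_pdf.
  - apply/measurable_EFinP/measurable_funM => //.
    exact: measurable_normal_pdf.
  move=> x _; rewrite -EFinM lee_fin !normal_pdfE ?mulf_neq0 // /normal_fun !subr0.
  have -> : normal_peak (2 * s) = normal_peak s / 2.
    rewrite /normal_peak -invfM; congr (_ ^-1).
    have -> : (2 * s) ^+ 2 * pi *+ 2 = 2 ^+ 2 * (s ^+ 2 * pi *+ 2) by ring.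
    by rewrite sqrtrM ?exprn_ge0 // sqrtr_sqr ger0_norm // mulrC.
  (* In terms of q the exponents of the two densities are - 4 q and - q, and
     x^(2n) is a multiple of q^n. *)
  pose q := x ^+ 2 / (8 * s ^+ 2).
  have q0 : 0 <= q by rewrite /q divr_ge0 ?sqr_ge0 // mulr_ge0 ?sqr_ge0.
  have -> : - x ^+ 2 / ((2 * s) ^+ 2 *+ 2) = - q by rewrite /q; field.
  have -> : - x ^+ 2 / (s ^+ 2 *+ 2) = - (4 * q) by rewrite /q; field.
  have -> : x ^+ (2 * n) = 8 ^+ n * s ^+ (2 * n) * q ^+ n.
    by rewrite exprM [s ^+ _]exprM -!exprMn; congr (_ ^+ _); rewrite /q; field.
  have h1 : q ^+ n * expR (- (4 * q)) <= n`!%:R * expR (- q).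
    apply: (@le_trans _ _ (n`!%:R * expR q * expR (- (4 * q)))).
      by rewrite ler_wpM2r ?expR_ge0 ?expr_le_expR.
    by rewrite -mulrA -expRD ler_wpM2l // ler_expR; lra.
  have p0 := normal_peak_ge0 s.
  have -> : c * (normal_peak s / 2 * expR (- q)) =
     8 ^+ n * s ^+ (2 * n) * normal_peak s * (n`!%:R * expR (- q)).
    by rewrite /c /normal_moment_const; field.
  have -> : 8 ^+ n * s ^+ (2 * n) * q ^+ n * (normal_peak s * expR (- (4 * q))) =
     8 ^+ n * s ^+ (2 * n) * normal_peak s * (q ^+ n * expR (- (4 * q))) by ring.
  by rewrite ler_wpM2l // !mulr_ge0 ?exprn_ge0 // ltW.
rewrite ge0_integralZl //.
- by rewrite integral_normal_pdf mule1.
- by apply/measurable_EFinP; exact: measurable_normal_pdf.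
- by move=> x _; rewrite lee_fin normal_pdf_ge0.
Qed.

End normal_moments.

(** Measurability with respect to a sub-sigma-algebra [G] is measurability on
    the type [g_sigma_algebraType G]. *)
Section sub_sigma_algebra.
Context (R : realType) d (T : measurableType d) (G : set (set T)).
Context (sG : sigma_algebra setT G) (Gm : G `<=` measurable).
Notation TG := (g_sigma_algebraType G).

Lemma sub_measurableP (X : T -> R) :
  sub_measurable G X <-> measurable_fun setT (X : TG -> R).
Proof.
have GE : (measurable : set (set TG)) = G by exact: sigma_algebra_id.
split=> [h _ B mB|h _ [B mB <-]]; first by rewrite GE; apply: h; exists B.
by rewrite -GE; exact: h.
Qed.

Lemma measurable_sub_id : measurable_fun setT (id : T -> TG).
Proof.
have GE : (measurable : set (set TG)) = G by exact: sigma_algebra_id.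
by move=> _ B; rewrite GE => GB; rewrite setTI; exact: Gm.
Qed.

Lemma sub_measurable_fun d' (T' : measurableType d') (X : T -> T') :
  measurable_fun setT (X : TG -> T') -> measurable_fun setT X.
Proof. by move=> h; exact: (measurableT_comp h measurable_sub_id). Qed.

End sub_sigma_algebra.

(** A centered Gaussian increment independent of a sigma-algebra. *)
Section independent_increment.
Context (R : realType) d (T : measurableType d) (P : probability T R).
Context (G : set (set T)) (sG : sigma_algebra setT G) (Gm : G `<=` measurable).
Context (D : T -> R) (mD : measurable_fun setT D) (s : R) (s0 : 0 < s).
Context (ind : forall A B, G A -> measurable B ->
  P (A `&` D @^-1` B) = (P A * normal_prob 0 s B)%E).
Notation TG := (g_sigma_algebraType G).
Local Open Scope ereal_scope.

Notation N := (normal_prob 0 s).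
Let mid : measurable_fun setT (id : T -> TG) := measurable_sub_id sG Gm.

Let idm : {mfun T >-> TG} := HB.pack (id : T -> TG)
  (isMeasurableFun.Build _ _ _ _ (id : T -> TG) mid).

Let withG (E : T -> R) : T -> TG * measurableTypeR R := fun w => (w, E w).

Let measurable_withG (E : T -> R) : measurable_fun setT E ->
  measurable_fun setT (withG E).
Proof.
by move=> mE; exact: (@measurable_fun_pair _ _ _ _ _ (measurableTypeR R)).
Qed.

(** Two variables with the law of the increment, given [G], have the same joint
    law with [G]. *)
Let joint_law (E : T -> R) : measurable_fun setT E ->
  (forall A B, G A -> measurable B -> P (A `&` E @^-1` B) = P A * N B) ->
  forall X : set (TG * measurableTypeR R), measurable X ->
  (distribution P idm \x N) X = pushforward P (withG E) X.
Proof.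
move=> mE indE X mX.
pose m' : {measure set (TG * measurableTypeR R) -> \bar R} := pushforward P (withG E).
apply: (@product_measure_unique _ _ _ _ _ (distribution P idm) N (m' (measurable_withG mE))) => // A B mA mB.
have GA : G A by move: mA; rewrite measurable_g_measurableTypeE.
by rewrite -indE.
Qed.

(** The expectation of a product factorizes, for nonnegative functions. *)
Lemma ge0_expectation_indep (X : T -> R) (psi : R -> R) :
  measurable_fun setT (X : TG -> R) -> (forall w, 0 <= X w)%R ->
  measurable_fun setT psi -> (forall x, 0 <= psi x)%R ->
  \int[P]_w (X w * psi (D w))%:E = \int[P]_w (X w)%:E * \int[N]_x (psi x)%:E.
Proof.
move=> mX X0 mpsi psi0.
pose F (z : TG * measurableTypeR R) : \bar R := (X z.1 * psi z.2)%:E.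
have mF : measurable_fun setT F.
  apply/measurable_EFinP/measurable_funM.
    exact: (measurableT_comp mX measurable_fst).
  exact: (measurableT_comp mpsi measurable_snd).
have F0 z : 0 <= F z by rewrite lee_fin mulr_ge0.
rewrite -[LHS]/(\int[P]_(w in withG D @^-1` setT) (F \o withG D) w).
rewrite -(ge0_integral_pushforward (measurable_withG mD)) //.
rewrite (eq_measure_integral (distribution P idm \x N)); last first.
  by move=> ? A mA _; exact: (esym (joint_law mD ind mA)).
  exact: measurable_withG.
rewrite (fubini_tonelli1 F) // /fubini_F /F /=.
under eq_integral => w _.
  under eq_integral do rewrite EFinM.
  rewrite ge0_integralZl //=; last 3 first.
    exact/measurable_EFinP.
    by move=> x _; rewrite lee_fin.
    by rewrite lee_fin.
  over.
rewrite /= ge0_integralZr //=; last 3 first.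
- exact/measurable_EFinP.
- by move=> x _; rewrite lee_fin.
- by apply: integral_ge0 => x _; rewrite lee_fin.
congr (_ * _); rewrite ge0_integral_pushforward //.
- exact/measurable_EFinP.
- by move=> x _; rewrite lee_fin.
Qed.

(** The increment and its opposite have the same joint law with [G], so that the
    expectation equals its own opposite. *)
Lemma expectation_indep_eq0 (X : T -> R) :
  measurable_fun setT (X : TG -> R) ->
  P.-integrable setT (fun w => (X w * D w)%:E) ->
  \int[P]_w (X w * D w)%:E = 0.
Proof.
move=> mX iXD.
pose F (z : TG * measurableTypeR R) : \bar R := (X z.1 * z.2)%:E.
have mF : measurable_fun setT F.
  apply/measurable_EFinP/measurable_funM; last exact: measurable_snd.
  exact: (measurableT_comp mX measurable_fst).
have mND : measurable_fun setT (\- D)%R by exact: measurable_funN.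
have indN A B : G A -> measurable B -> P (A `&` (\- D)%R @^-1` B) = P A * N B.
  move=> GA mB; rewrite -(normal_probN _ mB) ?gt_eqF // -ind //.
  by have := oppr_measurable measurableT mB; rewrite setTI.
have eqF E : measurable_fun setT E ->
  (forall A B, G A -> measurable B -> P (A `&` E @^-1` B) = P A * N B) ->
  P.-integrable setT (F \o withG E) ->
  \int[P]_w (X w * E w)%:E = \int[distribution P idm \x N]_z F z.
  move=> mE indE iE; rewrite -[LHS]/(\int[P]_(w in withG E @^-1` setT) (F \o withG E) w).
  rewrite -(integral_pushforward (measurable_withG mE)) //.
  rewrite (eq_measure_integral (distribution P idm \x N)) //.
    exact: measurable_withG.
  by move=> ? A mA _; exact: (esym (joint_law mE indE mA)).
have iN : P.-integrable setT (F \o withG (\- D)%R).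
  apply: eq_integrable (integrableN iXD) => // w _ /=.
  by rewrite /F /= mulrN EFinN.
have e1 := eqF D mD ind iXD; have := eqF _ mND indN iN; rewrite -e1.
under eq_integral do rewrite mulrN EFinN.
rewrite integralN /=; last first.
  by apply/integrable_add_def.
have : \int[P]_w (X w * D w)%:E \is a fin_num by exact: integrable_fin_num.
case: (\int[P]_w _) => // r _ [h]; congr EFin; lra.
Qed.

End independent_increment.

(** * Joint measurability of continuous processes *)

Section joint_measurability.
Context (R : realType) d (T : measurableType d) (X : R -> T -> R) (s t : R).
Context (mX : forall u, s <= u <= t -> measurable_fun setT (X u)).
Context (cX : forall w, {within `[s, t], continuous (fun u => X u w)}).

Let D : set (T * measurableTypeR R) := setT `*` `[s, t].

(* The approximating step processes take on the k-th cell [node, node + 1/(n+1)[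
   the value at the left end point; clamping the nodes to [s, t] only matters for
   cells that do not meet that interval. *)
Let node (n k : nat) : R := s + k%:R / n.+1%:R.
Let cell n (u : R) : nat := Num.truncn ((u - s) * n.+1%:R).

Let n0 (n : nat) : 0 < n.+1%:R :> R. Proof. by []. Qed.

Let cellP n (u : R) : s <= u -> node n (cell n u) <= u < node n (cell n u) + n.+1%:R^-1.
Proof.
move=> su; have u0 : 0 <= (u - s) * n.+1%:R by rewrite mulr_ge0 ?subr_ge0.
have := truncn_itv u0; rewrite -/(cell n u) /node => /andP[h1 h2].
apply/andP; split; first by rewrite -lerBrDl ler_pdivrMr.
rewrite -[X in _ + X]mul1r -addrA -mulrDl natr1 -ltrBlDl ltr_pdivlMr //.
Qed.

Let measurable_node n k : measurable_fun setT (X (Num.max s (Num.min t (node n k)))) \/ t < s.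
Proof.
have [ts|st] := ltP t s; [by right|left].
by apply: mX; rewrite le_max lexx /= ge_max st ge_min lexx.
Qed.

Let approx n (z : T * measurableTypeR R) : R :=
  X (Num.max s (Num.min t (node n (cell n z.2)))) z.1.

Let approxE n z : D z -> approx n z = X (node n (cell n z.2)) z.1.
Proof.
case=> _ /=; rewrite in_itv /= => /andP[su ut].
have /andP[h1 _] := cellP n su.
rewrite /approx min_r ?(le_trans h1) // max_r //.
by rewrite /node lerDl.
Qed.

Let measurable_approx n : s <= t -> measurable_fun D (approx n).
Proof.
move=> st mD B mB.
pose E k : set (T * measurableTypeR R) :=
  (X (Num.max s (Num.min t (node n k))) @^-1` B) `*`
  `[node n k, node n k + n.+1%:R^-1[.
have -> : D `&` approx n @^-1` B = D `&` \bigcup_k E k.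
  apply/seteqP; split=> [[w u] [Dz Bz]|[w u] [Dz [k _ [Bz Iz]]]]; split=> //.
    exists (cell n u) => //; split=> //=; rewrite in_itv /=.
    by apply: cellP; case: Dz => _ /=; rewrite in_itv /= => /andP[].
  suff e : approx n (w, u) = X (Num.max s (Num.min t (node n k))) w.
    by rewrite /preimage /mkset e.
  rewrite /approx /=; congr (X (Num.max _ (Num.min _ (node _ _))) _).
  apply: truncn_def; move: Iz; rewrite /= in_itv /= /node => /andP[h1 h2].
  rewrite -ler_pdivrMr // lerBrDl h1 /=.
  by rewrite -ltr_pdivlMr // ltrBlDl -natr1 mulrDl mul1r addrA.
apply: measurableI => //; apply: bigcupT_measurable => k.
apply: measurableX; last exact: measurable_itv.
by have [h|] := measurable_node n k; [rewrite -[X in measurable X]setTI; exact: h|rewrite ltNge st].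
Qed.

(** A process with continuous paths is jointly measurable. *)
Lemma measurable_joint : measurable_fun D (fun z => X z.2 z.1).
Proof.
have mD : measurable D by apply: measurableX => //; exact: measurable_itv.
have [st|ts] := leP s t; last first.
  suff -> : D = set0 by exact: measurable_fun_set0.
  apply/seteqP; split=> // -[w u] [_ /=]; rewrite in_itv /= => /andP[su ut].
  by move: (le_trans su ut); rewrite leNgt ts.
apply: (@measurable_fun_cvg _ _ _ _ approx); first by move=> n; exact: measurable_approx.
move=> [w u] Dz /=; have [_ /=] := Dz; rewrite in_itv /= => /andP[su ut].
have /subspace_continuousP cXw := @cX w.
have cw : X v w @[v --> within `[s, t] (nbhs (u : R))] --> X u w.
  by apply: cXw; rewrite /= in_itv /= su ut.
have : node n (cell n u) @[n --> \oo] --> within `[s, t] (nbhs u).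
  move=> A; rewrite /within /= => /nbhs_ballP[e e0 eA].
  have : \forall n \near \oo, n.+1%:R^-1 < e.
    by have := near_infty_natSinv_lt (PosNum e0).
  apply: filterS => n ne /=; apply: eA.
    rewrite /ball /= ltr_distl; have /andP[h1 h2] := cellP n su.
    by rewrite (lt_le_trans _ h1) ?gtrBl // (lt_trans h2) // ltrD2l.
  have /andP[h1 _] := cellP n su.
  by rewrite in_itv /= (le_trans h1 ut) andbT /node lerDl.
move=> /(cvg_comp _ _)/(_ cw); apply: cvg_trans; apply: near_eq_cvg.
by apply: nearW => n; rewrite /= approxE.
Qed.

End joint_measurability.

(** * Simple processes and Brownian increments *)

Section simple_processes.
Context (R : realType) (Omega : Type) (p : nat -> R) (c : nat -> R).
Implicit Types (u : R) (n : nat).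

Lemma step_nodes_le n : (forall k, (k < n)%N -> p k < p k.+1) ->
  forall a b, (a <= b)%N -> (b <= n)%N -> p a <= p b.
Proof.
move=> hp a b ab; rewrite -(subnKC ab); move: (b - a)%N => l {ab b}.
elim: l => [|l IHl] ab; first by rewrite addn0.
rewrite addnS; apply: (@le_trans _ _ (p (a + l)%N)).
  by apply: IHl; rewrite (leq_trans _ ab) // addnS.
by apply/ltW/hp; rewrite -addnS.
Qed.

(** The steps of a simple process have disjoint supports. *)
Lemma sqr_step_sum n u : (forall k, (k < n)%N -> p k < p k.+1) ->
  (\sum_(k < n) c k * \1_(`]p k, p k.+1]) u) ^+ 2 =
  \sum_(k < n) c k ^+ 2 * \1_(`]p k, p k.+1]) u.
Proof.
elim: n => [|n IH] hp; first by rewrite !big_ord0 expr0n.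
rewrite !big_ord_recr /= -IH => [|k kn]; last by apply: hp; exact: ltnW.
set S := \sum_(k < n) _.
rewrite indicE; case: (boolP (u \in _)) => /= [|_]; last by rewrite !mulr0 !addr0.
rewrite inE /= in_itv /= => /andP[pu _].
have -> : S = 0.
  rewrite /S big1 // => k _; rewrite indicE.
  rewrite (_ : u \in _ = false) ?mulr0 //; apply/negbTE; rewrite notin_setE /= in_itv /=.
  by case/andP => _; rewrite leNgt (le_lt_trans _ pu) // (step_nodes_le hp).
by rewrite expr0n !add0r mulr1 mulr1.
Qed.

Lemma integral_sqr_step_sum n : (forall k, (k < n)%N -> p k < p k.+1) ->
  (\int[lebesgue_measure]_(u in `[p 0, p n])
     ((\sum_(k < n) c k * \1_(`]p k, p k.+1]) u) ^+ 2)%:E)%E =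
  (\sum_(k < n) c k ^+ 2 * (p k.+1 - p k))%:E.
Proof.
move=> hp.
have le_p := step_nodes_le hp.
under eq_integral do rewrite sqr_step_sum // -sumEFin.
rewrite ge0_integral_sum //; last 2 first.
- by move=> k; apply/measurable_EFinP; apply: measurable_funM.
- by move=> k u _; rewrite lee_fin mulr_ge0 // sqr_ge0.
rewrite -sumEFin; apply: eq_bigr => k _.
under eq_integral do rewrite EFinM.
rewrite ge0_integralZl //=; last 2 first.
- by apply/measurable_EFinP; exact: measurable_indic.
- by rewrite lee_fin sqr_ge0.
rewrite integral_indic //=.
rewrite (_ : _ `&` _ = `]p k, p k.+1]%classic); last first.
  apply/setIidPl => u; rewrite /= !in_itv /= => /andP[h1 h2]; apply/andP; split.
    by apply: le_trans (ltW h1); exact: le_p (ltnW (ltn_ord k)).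
  by apply: (le_trans h2); exact: le_p.
by rewrite lebesgue_measure_itv /= lte_fin hp // -EFinB -EFinM.
Qed.

End simple_processes.

Section brownian.
Context (R : realType) d (T : measurableType d) (P : probability T R).
Context (H : R) (F : R -> set (set T)) (hF : filtration H F).

(** A one-dimensional Brownian motion on [0, H] with respect to [F], without
    condition on its initial value. *)
Definition scalar_brownian (B : R -> T -> R) : Prop :=
  [/\ forall t, 0 <= t <= H -> sub_measurable (F t) (B t),
      forall w, {within `[0, H], continuous (fun t => B t w)} &
      forall s t, 0 <= s -> s < t -> t <= H ->
      forall A (C : set R), F s A -> measurable C ->
        P (A `&` [set w | C (B t w - B s w)]) =
        (P A * normal_prob 0 (Num.sqrt (t - s)) C)%E].

Lemma brownian_coordinate (m : nat) (W : 'I_m -> R -> T -> R) (r : 'I_m) :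
  brownian_motion P H F W -> scalar_brownian (W r).
Proof.
case=> ad _ cont ind; split=> //; first exact: ad.
move=> s t s0 st tT A C FA mC.
have := ind s t s0 st tT A (fun i => if i == r then C else setT) FA.
rewrite (bigD1 r) //= eqxx big1 => [|i /negbTE ->]; last by rewrite probability_setT.
rewrite mule1 => <- => [|i]; last by case: ifP.
congr (P (_ `&` _)); apply/seteqP; split=> [w Cw i /=|w /(_ r)] /=; last by rewrite eqxx.
by case: eqP => // ->.
Qed.

Let sF t : 0 <= t <= H -> sigma_algebra setT (F t).
Proof. by case: hF => h _ _; exact: h. Qed.
Let Fm t : 0 <= t <= H -> F t `<=` measurable.
Proof. by case: hF => _ h _; exact: h. Qed.

Local Notation "X \isF t" := (measurable_fun setT (X : g_sigma_algebraType (F t) -> R))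
  (at level 70).

Lemma measurable_le_filtration s t (X : T -> R) :
  0 <= s -> s <= t -> t <= H -> X \isF s -> X \isF t.
Proof.
move=> s0 st tT; have hs : 0 <= s <= H by rewrite s0 (le_trans st).
have ht : 0 <= t <= H by rewrite (le_trans s0 st).
move=> /(sub_measurableP (sF hs)) h; apply/(sub_measurableP (sF ht)).
by case: hF => _ _ mono; exact: subset_trans h (mono _ _ s0 st tT).
Qed.

Lemma measurable_filtration t (X : T -> R) : 0 <= t <= H -> X \isF t ->
  measurable_fun setT X.
Proof. by move=> ht hX; exact: (sub_measurable_fun (sF ht) (Fm ht) hX). Qed.

Lemma adapted_measurable B t : scalar_brownian B -> 0 <= t <= H -> B t \isF t.
Proof. by case=> ad _ _ ht; apply/(sub_measurableP (sF ht)); exact: ad. Qed.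

Lemma measurable_increment B s t : scalar_brownian B -> 0 <= s -> s <= t -> t <= H ->
  (fun w => B t w - B s w) \isF t.
Proof.
move=> hB s0 st tT; apply: measurable_funB.
  by apply: adapted_measurable => //; rewrite (le_trans s0 st).
apply: measurable_le_filtration (adapted_measurable hB _) => //.
by rewrite s0 (le_trans st).
Qed.

Section increments.
Context (B : R -> T -> R) (hB : scalar_brownian B).
Context (s t : R) (s0 : 0 <= s) (st : s < t) (tT : t <= H).
Let hs : 0 <= s <= H. Proof. by rewrite s0 (le_trans (ltW st)). Qed.
Let ht : 0 <= t <= H. Proof. by rewrite (le_trans s0 (ltW st)). Qed.

Let sq0 : 0 < Num.sqrt (t - s). Proof. by rewrite sqrtr_gt0 subr_gt0. Qed.

Let mI : measurable_fun setT (fun w => B t w - B s w).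
Proof. by apply: (measurable_filtration ht); apply: measurable_increment => //; exact: ltW. Qed.

Let indI A C : F s A -> measurable C ->
  P (A `&` (fun w => B t w - B s w) @^-1` C) =
  (P A * normal_prob 0 (Num.sqrt (t - s)) C)%E.
Proof. by case: hB => _ _ ind; exact: ind. Qed.

Lemma increment_moment (X : T -> R) (n : nat) : X \isF s -> (forall w, 0 <= X w) ->
  (\int[P]_w (X w * (B t w - B s w) ^+ (2 * n))%:E <=
   (normal_moment_const R n * (t - s) ^+ n)%:E * \int[P]_w (X w)%:E)%E.
Proof.
move=> mX X0.
rewrite (ge0_expectation_indep (sF hs) (Fm hs) mI indI (psi := fun x => x ^+ (2 * n)) mX X0) //.
- have EX0 : (0 <= \int[P]_w (X w)%:E)%E by apply: integral_ge0 => w _; rewrite lee_fin.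
  rewrite muleC lee_wpmul2r //; have := normal_moment_le n sq0.
  by rewrite [X in (_ * X)%:E]exprM sqr_sqrtr // subr_ge0 ltW.
- by move=> x; rewrite exprM exprn_ge0 // sqr_ge0.
Qed.

Lemma increment_mean (X : T -> R) : X \isF s ->
  P.-integrable setT (fun w => (X w * (B t w - B s w))%:E) ->
  (\int[P]_w (X w * (B t w - B s w))%:E = 0)%E.
Proof. by move=> mX; exact: (expectation_indep_eq0 (sF hs) (Fm hs) mI sq0 indI mX). Qed.

End increments.

End brownian.

(** * Second moments of iterated integrals *)

(** Tonelli's theorem for functions that are jointly measurable only on a time
    interval. *)
Section tonelli_interval.
Local Open Scope ereal_scope.
Context (R : realType) d (T : measurableType d) (P : probability T R) (s t : R).
Context (G : T * measurableTypeR R -> R).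
Context (mG : measurable_fun ([set: T] `*` `[s, t] : set (T * measurableTypeR R)) G).
Context (G0 : forall z, (0 <= G z)%R).

Let D : set (T * measurableTypeR R) := [set: T] `*` `[s, t].
Let f := (EFin \o G) \_ D.

Let mf : measurable_fun setT f.
Proof.
have mD : measurable D by apply: measurableX => //; exact: measurable_itv.
have h : measurable_fun D (EFin \o G) by exact/measurable_EFinP.
exact: ((measurable_restrictT (EFin \o G) mD).1 h).
Qed.

Let f0 z : 0 <= f z.
Proof. by rewrite /f patchE; case: ifP => // _; rewrite lee_fin. Qed.

Let fE w : \int[lebesgue_measure]_(u in `[s, t]) (G (w, u))%:E = fubini_F lebesgue_measure f w.
Proof.
rewrite integral_mkcond; apply: eq_integral => u _; rewrite /f !patchE.
suff -> : ((w, u) \in D) = (u \in (`[s, t]%classic : set (measurableTypeR R))) by [].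
by apply/idP/idP; rewrite !inE => // -[].
Qed.

Lemma measurable_interval_section w :
  measurable_fun (`[s, t]%classic : set (measurableTypeR R)) (fun u => (G (w, u))%:E).
Proof.
have mI : measurable (`[s, t]%classic : set (measurableTypeR R)) by exact: measurable_itv.
apply: ((measurable_restrictT (fun u => (G (w, u))%:E) mI).2 _).
have := measurable_fun_pair2 w mf; congr (measurable_fun _ _); apply/funext => u.
rewrite /f !patchE.
suff -> : ((w, u) \in D) = (u \in (`[s, t]%classic : set (measurableTypeR R))) by [].
by apply/idP/idP; rewrite !inE // => -[].
Qed.

Lemma measurable_interval_integral :
  measurable_fun setT (fun w => \int[lebesgue_measure]_(u in `[s, t]) (G (w, u))%:E).
Proof.
rewrite (_ : (fun w => _) = fubini_F lebesgue_measure f); last by apply/funext => w; exact: fE.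
exact: measurable_fun_fubini_tonelli_F.
Qed.

Lemma tonelli_interval :
  \int[P]_w \int[lebesgue_measure]_(u in `[s, t]) (G (w, u))%:E =
  \int[lebesgue_measure]_(u in `[s, t]) \int[P]_w (G (w, u))%:E.
Proof.
under eq_integral do rewrite fE /fubini_F.
rewrite (fubini_tonelli f) // [RHS]integral_mkcond; apply: eq_integral => u _.
rewrite patchE; case: ifPn => us; rewrite /f.
  apply: eq_integral => w _; rewrite patchE.
  by rewrite (_ : (w, u) \in D) // inE; split=> //; exact: set_mem.
apply: integral0_eq => w _; rewrite patchE (_ : (w, u) \in D = false) //.
by apply/negbTE/negP => /set_mem[_ /= h]; move/negP: us; apply; exact/mem_set.
Qed.

End tonelli_interval.

Section ito_moment.
Context (R : realType) d (T : measurableType d) (P : probability T R).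
Context (H : R) (F : R -> set (set T)) (hF : filtration H F).
Context (B : R -> T -> R) (hB : scalar_brownian P H F B).

Local Notation "X \isF t" := (measurable_fun setT (X : g_sigma_algebraType (F t) -> R))
  (at level 70).
Notation kap := (normal_moment_const R 1).

Let sF t : 0 <= t <= H -> sigma_algebra setT (F t).
Proof. by case: hF => h _ _; exact: h. Qed.

Let kap0 : 0 <= kap. Proof. exact: normal_moment_const_ge0. Qed.

(** Half of the Ito isometry for elementary integrals, localized by a bounded
    weight that is known at the initial time. It is proved by induction on the
    number of steps: the cross term with the last increment has mean zero. *)
Lemma simple_integral_moment (s t M : R) (h : simple_process R T) (X : T -> R) :
  0 <= s -> t <= H -> simple_on F s t h -> X \isF s -> (forall w, 0 <= X w <= M) ->
  (\int[P]_w (X w * simple_integral B h w ^+ 2)%:E <=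
   kap%:E * \int[P]_w (X w *
     \sum_(k < sp_size h) sp_coef h k w ^+ 2 * (sp_node h k.+1 - sp_node h k))%:E)%E.
Proof.
move=> s0 tH [ps pt pinc hc] mX X0M.
have X0 w : 0 <= X w by case/andP: (X0M w).
set p := sp_node h; set c := sp_coef h; set N := sp_size h.
have le_p := step_nodes_le pinc.
have p_ge k : (k <= N)%N -> 0 <= p k.
  by move=> kN; rewrite (le_trans s0) // -ps; exact: le_p.
have p_le k : (k <= N)%N -> p k <= H.
  by move=> kN; apply: le_trans tH; rewrite -pt; exact: le_p.
have p_in k : (k <= N)%N -> 0 <= p k <= H by move=> kN; rewrite p_ge ?p_le.
have s_p k : (k <= N)%N -> s <= p k by move=> kN; rewrite -ps; exact: le_p.
pose S n w := \sum_(k < n) c k w * (B (p k.+1) w - B (p k) w).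
pose Q n w := \sum_(k < n) c k w ^+ 2 * (p k.+1 - p k).
have mup a b (Z : T -> R) : (a <= b)%N -> (b <= N)%N -> Z \isF p a -> Z \isF p b.
  move=> ab bN; apply: (measurable_le_filtration hF); rewrite ?p_ge ?p_le ?le_p //.
  exact: leq_trans bN.
have mXp k : (k <= N)%N -> X \isF p k.
  by move=> kN; apply: (mup 0%N) => //; rewrite /p ps.
have mc k : (k < N)%N -> c k \isF p k.
  by move=> kN; apply/(sub_measurableP (sF (p_in _ (ltnW kN)))); case: (hc k kN).
have mdB k : (k < N)%N -> (fun w => B (p k.+1) w - B (p k) w) \isF p k.+1.
  move=> kN; apply: (measurable_increment hF hB); rewrite ?p_ge ?p_le ?le_p //; exact: ltnW.
have mS n : (n <= N)%N -> S n \isF p n.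
  elim: n => [|n IH] nN.
    by rewrite /S; under eq_fun do rewrite big_ord0; exact: measurable_cst.
  rewrite /S; under eq_fun do rewrite big_ord_recr /=.
  apply: measurable_funD; first by apply: (mup n) => //; exact: IH (ltnW nN).
  by apply: measurable_funM; [apply: (mup n) => //; exact: mc|exact: mdB].
have mT k (Z : T -> R) : (k <= N)%N -> Z \isF p k -> measurable_fun setT Z.
  by move=> kN; apply: (measurable_filtration hF); exact: p_in.
have mQ n : (n <= N)%N -> measurable_fun setT (Q n).
  elim: n => [|n IH] nN.
    by rewrite /Q; under eq_fun do rewrite big_ord0; exact: measurable_cst.
  rewrite /Q; under eq_fun do rewrite big_ord_recr /=.
  apply: measurable_funD; first exact: IH (ltnW nN).
  apply: measurable_funM => //; apply: measurable_funX.
  by apply: (mT n); [exact: ltnW|exact: mc].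
have Q0 n w : (n <= N)%N -> 0 <= Q n w.
  move=> nN; apply: sumr_ge0 => k _; rewrite mulr_ge0 ?sqr_ge0 ?subr_ge0 //.
  by apply: le_p => //; rewrite (leq_trans (ltn_ord k)).
have mTX : measurable_fun setT X by apply: (mT 0%N) => //; exact: mXp.
suff : forall n, (n <= N)%N ->
    (\int[P]_w (X w * S n w ^+ 2)%:E <= kap%:E * \int[P]_w (X w * Q n w)%:E)%E /\
    (\int[P]_w (X w * S n w ^+ 2)%:E < +oo)%E by move=> /(_ N (leqnn N))[].
elim=> [_|n IH nN].
  have e0 : (\int[P]_w (X w * S 0%N w ^+ 2)%:E = 0)%E.
    by apply: integral0_eq => w _; rewrite /S big_ord0 expr0n mulr0.
  rewrite e0; split=> //; apply: mule_ge0 => //; apply: integral_ge0 => w _.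
  by rewrite lee_fin mulr_ge0 ?Q0.
have [le1 fin1] := IH (ltnW nN).
set dB := fun w => B (p n.+1) w - B (p n) w.
have mcn := mc n nN; have mSn := mS n (ltnW nN); have mXn := mXp n (ltnW nN).
(* X S_(n+1)^2 = a + b + y. *)
pose a w := X w * S n w ^+ 2.
pose b w := X w * c n w ^+ 2 * dB w ^+ 2.
pose y w := (2 * X w * S n w * c n w) * dB w.
have a0 w : 0 <= a w by rewrite mulr_ge0 ?sqr_ge0.
have b0 w : 0 <= b w by rewrite mulr_ge0 ?sqr_ge0 // mulr_ge0 ?sqr_ge0.
have mdBT : measurable_fun setT dB by apply: (mT n.+1) => //; exact: mdB.
have mcT : measurable_fun setT (c n) by apply: (mT n) => //; exact: ltnW.
have mST : measurable_fun setT (S n) by apply: (mT n) => //; exact: ltnW.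
have ma : measurable_fun setT a by do ?[apply: measurable_funM => //|apply: measurable_funX => //].
have mb : measurable_fun setT b.
  by do ?[apply: measurable_funM => //|apply: measurable_funX => //].
have my : measurable_fun setT y by do ?apply: measurable_funM.
pose q w := X w * (c n w ^+ 2 * (p n.+1 - p n)).
have q0 w : 0 <= q w.
  by rewrite mulr_ge0 // mulr_ge0 ?sqr_ge0 // subr_ge0 ltW // pinc.
have mq : measurable_fun setT q.
  by do ?[apply: measurable_funM => //|apply: measurable_funX => //].
have le_b : (\int[P]_w (b w)%:E <= kap%:E * \int[P]_w (q w)%:E)%E.
  have mXc : (fun w => X w * c n w ^+ 2) \isF p n.
    by do ?[apply: measurable_funM => //|apply: measurable_funX => //].
  have := increment_moment hF hB (p_ge n (ltnW nN)) (pinc n nN) (p_le n.+1 nN) 1 mXc.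
  rewrite muln1 expr1 => le_b; apply: (le_trans (le_b _)).
    by move=> w; rewrite mulr_ge0 ?sqr_ge0.
  rewrite le_eqVlt; apply/orP; left; apply/eqP.
  rewrite EFinM -muleA; congr (_ * _)%E; rewrite -ge0_integralZl //.
  - by apply: eq_integral => w _; rewrite -EFinM /q mulrA mulrC.
  - by apply/measurable_EFinP; exact: (mT n (fun w => X w * c n w ^+ 2) (ltnW nN)).
  - by move=> w _; rewrite lee_fin mulr_ge0 ?sqr_ge0.
  - by rewrite lee_fin subr_ge0 ltW // pinc.
have fin_q : (\int[P]_w (q w)%:E < +oo)%E.
  have [_ [Mc hMc]] := hc n nN.
  pose K := M * (Mc ^+ 2 * (p n.+1 - p n)).
  apply: (@le_lt_trans _ _ (\int[P]_w K%:E)%E); last first.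
    by rewrite integral_cst //= probability_setT mule1 ltry.
  apply: ge0_le_lower_integral => w _; rewrite lee_fin //.
  have [X0w XMw] := andP (X0M w).
  have dp : 0 <= p n.+1 - p n by rewrite subr_ge0 (ltW (pinc n nN)).
  apply: ler_pM => //; first by rewrite mulr_ge0 ?sqr_ge0.
  rewrite ler_wpM2r // -[leLHS]real_normK ?num_real //.
  by rewrite lerXn2r ?nnegrE ?(le_trans (normr_ge0 _) (hMc w)).
have fin_b : (\int[P]_w (b w)%:E < +oo)%E.
  by apply: (le_lt_trans le_b); apply: lte_mul_pinfty.
have int_ge0 (f : T -> R) : measurable_fun setT f -> (forall w, 0 <= f w) ->
    (\int[P]_w (f w)%:E < +oo)%E -> P.-integrable setT (EFin \o f).
  move=> mf f0 lf; apply/integrableP; split; first exact/measurable_EFinP.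
  by under eq_integral do rewrite /= ger0_norm //.
have ia : P.-integrable setT (EFin \o a) by exact: int_ge0.
have ib : P.-integrable setT (EFin \o b) by exact: int_ge0.
have iab : P.-integrable setT (EFin \o (fun w => a w + b w)).
  by apply: eq_integrable (integrableD _ ia ib) => // w _ /=; rewrite EFinD.
have iy : P.-integrable setT (EFin \o y).
  apply: (le_integrable _ _ _ iab) => //; first exact/measurable_EFinP.
  move=> w _ /=; rewrite lee_fin [leRHS]ger0_norm ?addr_ge0 //.
  have -> : y w = X w * (2 * S n w * (c n w * dB w)) by rewrite /y; ring.
  have -> : a w + b w = X w * (S n w ^+ 2 + (c n w * dB w) ^+ 2) by rewrite /a /b; ring.
  rewrite normrM (ger0_norm (X0 w)) ler_wpM2l //; move: (S n w) (c n w * dB w) => u v.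
  by rewrite ler_norml; have := sqr_ge0 (u - v); have := sqr_ge0 (u + v); nra.
have y_eq0 : (\int[P]_w (y w)%:E = 0)%E.
  apply: (increment_mean hF hB (p_ge n (ltnW nN)) (pinc n nN) (p_le n.+1 nN)) => //.
  by do ?apply: measurable_funM.
have eS : (\int[P]_w (X w * S n.+1 w ^+ 2)%:E =
    \int[P]_w (a w)%:E + \int[P]_w (b w)%:E)%E.
  have -> : (\int[P]_w (X w * S n.+1 w ^+ 2)%:E =
      \int[P]_w ((a w + b w)%:E + (y w)%:E))%E.
    apply: eq_integral => w _; rewrite -EFinD; congr EFin.
    by rewrite /S big_ord_recr /= -/(S n w) -/(dB w) /a /b /y; ring.
  rewrite integralD // y_eq0 adde0; under eq_integral do rewrite EFinD.
  by rewrite integralD.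
have eQ : (\int[P]_w (X w * Q n.+1 w)%:E =
    \int[P]_w (X w * Q n w)%:E + \int[P]_w (q w)%:E)%E.
  rewrite -ge0_integralD //.
  - apply: eq_integral => w _; rewrite -EFinD; congr EFin.
    by rewrite /Q big_ord_recr /= mulrDr.
  - by move=> w _; rewrite lee_fin mulr_ge0 // Q0 // ltnW.
  - by apply/measurable_EFinP/measurable_funM => //; apply: mQ; exact: ltnW.
  - by move=> w _; rewrite lee_fin.
  - exact/measurable_EFinP.
split; last by rewrite eS lte_add_pinfty.
rewrite eS eQ ge0_muleDr; last 2 first.
- by apply: integral_ge0 => w _; rewrite lee_fin mulr_ge0 // Q0 // ltnW.
- by apply: integral_ge0 => w _; rewrite lee_fin.
exact: leeD.
Qed.

(** The constant in the second moment of an iterated integral: one factor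
    [normal_moment_const R 1] comes from the integrator, one from the integrand,
    and 4 from the two comparisons of squares. *)
Definition ito_moment_const : R := 4 * normal_moment_const R 1 ^+ 2.

Lemma ito_moment_const_ge0 : 0 <= ito_moment_const.
Proof. by rewrite mulr_ge0 // sqr_ge0. Qed.

(** Conditional second moment of an iterated integral, for a bounded weight.
    The elementary integrals approximating it satisfy the corresponding bound up
    to errors that vanish in the limit. *)
Let ito_bounded_moment (A : R -> T -> R) (s t M : R) (J X : T -> R) :
  scalar_brownian P H F A -> 0 <= s -> s < t -> t <= H ->
  is_ito_integral P F B s t (fun u w => A u w - A s w) J ->
  X \isF s -> (forall w, 0 <= X w <= M) ->
  (\int[P]_w (X w * J w ^+ 2)%:E <=
   (ito_moment_const * (t - s) ^+ 2)%:E * \int[P]_w (X w)%:E)%E.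
Proof.
move=> hA s0 st tH [mJ [h [hs cvgh cvgS]]] mX X0M.
have X0 w : 0 <= X w by case/andP: (X0M w).
have XM w : X w <= M by case/andP: (X0M w).
have M0 : 0 <= M := le_trans (X0 point) (XM point).
have hst u : s <= u <= t -> 0 <= u <= H.
  by case/andP=> su ut; rewrite (le_trans s0 su) (le_trans ut tH).
have s_in : 0 <= s <= H by apply: hst; rewrite lexx ltW.
have mTX : measurable_fun setT X by exact: (measurable_filtration hF s_in mX).
pose dA (z : T * measurableTypeR R) := A z.2 z.1 - A s z.1.
pose D : set (T * measurableTypeR R) := [set: T] `*` `[s, t].
have mD : measurable D by apply: measurableX => //; exact: measurable_itv.
have mdA : measurable_fun D dA.
  apply: (@measurable_joint _ _ T (fun u w => A u w - A s w) s t) => [u us|w].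
    case/andP: (us) => su ut.
    apply: (measurable_filtration hF (hst _ us)).
    exact: (measurable_increment hF hA s0 su (le_trans ut tH)).
  have [_ cA _] := hA.
  move=> u; apply: (@continuousB _ _ _ (fun u : subspace `[s, t] => A u w) (fun=> A s w)).
    apply: (continuous_subspaceW _ (cA w)) => v /=; rewrite !in_itv /= => /hst.
    by [].
  exact: cst_continuous.
(* Everything below lives on the product of the probability space and the time
   axis. *)
pose sv k (z : T * measurableTypeR R) := simple_value (h k) z.2 z.1.
have mcoef k l : (l < sp_size (h k))%N -> measurable_fun setT (sp_coef (h k) l).
  move=> lN; have [ps pt pinc hc] := hs k; have [hm _] := hc l lN.
  have le_p := step_nodes_le pinc.
  have pin : 0 <= sp_node (h k) l <= H.
    by apply: hst; rewrite -ps -pt !le_p // ltnW.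
  exact: (measurable_filtration hF pin ((sub_measurableP (sF pin) _).1 hm)).
have mB k l : (l <= sp_size (h k))%N -> measurable_fun setT (B (sp_node (h k) l)).
  move=> lN; have [ps pt pinc hc] := hs k.
  have le_p := step_nodes_le pinc.
  have pin : 0 <= sp_node (h k) l <= H.
    by apply: hst; rewrite -ps -pt !le_p.
  exact: (measurable_filtration hF pin (adapted_measurable hF hB pin)).
have msv k : measurable_fun setT (sv k).
  apply: measurable_sum => l; apply: measurable_funM.
    exact: (measurableT_comp (mcoef _ _ (ltn_ord l)) measurable_fst).
  have mi : measurable (`]sp_node (h k) l, sp_node (h k) l.+1]%classic : set (measurableTypeR R)).
    exact: measurable_itv.
  exact: (measurableT_comp (@measurable_indic _ (measurableTypeR R) R setT _ mi) measurable_snd).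
pose S k := simple_integral B (h k).
have mS k : measurable_fun setT (S k).
  apply: measurable_sum => l; apply: measurable_funM; first exact: mcoef.
  by apply: measurable_funB; apply: mB => //; exact: ltnW.
pose G k z := (sv k z - dA z) ^+ 2.
have mG k : measurable_fun D (G k).
  apply: measurable_funX; apply: measurable_funB => //.
  exact: measurable_funS (msv k).
have G0 k z : 0 <= G k z by exact: sqr_ge0.
pose V k w := (\int[lebesgue_measure]_(u in `[s, t]) (G k (w, u))%:E)%E.
have V0 k w : (0 <= V k w)%E by apply: integral_ge0 => u _; rewrite lee_fin sqr_ge0.
have mV k : measurable_fun setT (V k).
  by apply: (measurable_interval_integral (mG k)) => z; exact: sqr_ge0.
pose U w := (\int[lebesgue_measure]_(u in `[s, t]) (X w * dA (w, u) ^+ 2)%:E)%E.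
pose GU z := X z.1 * dA z ^+ 2.
have mGU : measurable_fun D GU.
  apply: measurable_funM; last exact: measurable_funX.
  apply: (measurable_funS measurableT) => //.
  exact: (measurableT_comp mTX measurable_fst).
have GU0 z : 0 <= GU z by rewrite mulr_ge0 // sqr_ge0.
have U0 w : (0 <= U w)%E by apply: integral_ge0 => u _; rewrite lee_fin (GU0 (w, u)).
have mU : measurable_fun setT U by exact: (measurable_interval_integral mGU GU0).
have leU : (\int[P]_w U w <= (kap * (t - s) ^+ 2)%:E * \int[P]_w (X w)%:E)%E.
  rewrite (tonelli_interval P mGU GU0).
  have EX0 : (0 <= \int[P]_w (X w)%:E)%E by apply: integral_ge0 => w _; rewrite lee_fin.
  apply: (@le_trans _ _ (\int[lebesgue_measure]_(u in `[s, t])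
     cst ((kap * (t - s))%:E * \int[P]_w (X w)%:E)%E u)%E).
    apply: ge0_le_lower_integral => u; rewrite /= in_itv /= => /andP[su ut].
      by apply: integral_ge0 => w _; rewrite lee_fin GU0.
    have [us|us] := eqVneq u s.
      rewrite integral0_eq => [|w _]; last by rewrite /GU /dA /= us subrr expr0n mulr0.
      by apply: mule_ge0 => //; rewrite lee_fin mulr_ge0 // subr_ge0 ltW.
    have {}su : s < u by rewrite lt_neqAle eq_sym us.
    have := increment_moment hF hA s0 su (le_trans ut tH) 1 mX X0.
    rewrite muln1 expr1 => /le_trans; apply; apply: lee_wpmul2r => //.
    by rewrite lee_fin ler_wpM2l // lerD2r.
  rewrite integral_cst /=; last exact: measurable_itv.
  rewrite lebesgue_measure_itv /= lte_fin st -EFinB muleAC -EFinM.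
  by rewrite -mulrA expr2.
(* Compare J with the k-th elementary integral, and the k-th simple process with
   the integrand. *)
have key k : (\int[P]_w (X w * J w ^+ 2)%:E <=
   ((2 * M)%:E * 'E_P[fun w => ((S k w - J w) ^+ 2)%R] +
    (kap * (4 * M))%:E * \int[P]_w V k w) +
   (ito_moment_const * (t - s) ^+ 2)%:E * \int[P]_w (X w)%:E)%E.
  have EX0 : (0 <= \int[P]_w (X w)%:E)%E by apply: integral_ge0 => w _; rewrite lee_fin.
  rewrite unlock.
  pose Q w := \sum_(l < sp_size (h k))
    sp_coef (h k) l w ^+ 2 * (sp_node (h k) l.+1 - sp_node (h k) l).
  have [ps pt pinc hc] := hs k.
  have sQ w : (\int[lebesgue_measure]_(u in `[s, t]) (sv k (w, u) ^+ 2)%:E = (Q w)%:E)%E.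
    rewrite -(integral_sqr_step_sum (fun l => sp_coef (h k) l w) pinc) ps pt.
    by [].
  have leQ w : ((X w * Q w)%:E <= (2 * M)%:E * V k w + 2%:E * U w)%E.
    have mitv : measurable (`[s, t]%classic : set (measurableTypeR R)).
      exact: measurable_itv.
    have mGw := measurable_interval_section (mG k) w.
    have mUw := measurable_interval_section mGU w.
    have msw := measurable_interval_section
      (measurable_funS measurableT (@subsetT _ D) (measurable_funX 2 (msv k))) w.
    rewrite EFinM -sQ -ge0_integralZl //; last 2 first.
    - by move=> u _; rewrite lee_fin sqr_ge0.
    - by rewrite lee_fin.
    rewrite /V /U -!ge0_integralZl //; last 3 first.
    - by move=> u _; rewrite lee_fin (GU0 (w, u)).
    - by move=> u _; rewrite lee_fin (G0 k (w, u)).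
    - by rewrite lee_fin mulr_ge0.
    rewrite -ge0_integralD //; last 4 first.
    - by move=> u _; rewrite -EFinM lee_fin; apply: mulr_ge0; [exact: mulr_ge0|exact: G0].
    - exact: emeasurable_funM.
    - by move=> u _; rewrite -EFinM lee_fin; apply: mulr_ge0 => //; exact: GU0 (w, u).
    - exact: emeasurable_funM.
    apply: ge0_le_lower_integral => u _; rewrite -?EFinM -?EFinD lee_fin.
      by rewrite mulr_ge0 // sqr_ge0.
    rewrite /G /=; move: (sv k (w, u)) (dA (w, u)) (X0 w) (XM w) => a b x0 xM.
    have h1 : a ^+ 2 <= 2 * (a - b) ^+ 2 + 2 * b ^+ 2 by have := sqr_ge0 (a - 2 * b); nra.
    apply: (le_trans (ler_wpM2l x0 h1)); rewrite mulrDr [2 * (X w * _)]mulrCA lerD2r.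
    by rewrite mulrA ler_wpM2r ?sqr_ge0 // mulrC ler_pM2l.
  have EV0 : (0 <= \int[P]_w V k w)%E by apply: integral_ge0.
  have EU0 : (0 <= \int[P]_w U w)%E by apply: integral_ge0.
  have mS2 : measurable_fun setT (fun w => (S k w - J w) ^+ 2).
    by apply: measurable_funX; exact: measurable_funB.
  have mXS : measurable_fun setT (fun w => X w * S k w ^+ 2).
    by apply: measurable_funM => //; exact: measurable_funX.
  have e1 : (\int[P]_w (X w * J w ^+ 2)%:E <=
      (2 * M)%:E * \int[P]_w ((S k w - J w) ^+ 2)%:E +
      2%:E * \int[P]_w (X w * S k w ^+ 2)%:E)%E.
    rewrite -!ge0_integralZl //; last 5 first.
    - exact/measurable_EFinP.
    - by move=> w _; rewrite lee_fin mulr_ge0 // sqr_ge0.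
    - exact/measurable_EFinP.
    - by move=> w _; rewrite lee_fin sqr_ge0.
    - by rewrite lee_fin mulr_ge0.
    rewrite -ge0_integralD //; last 4 first.
    - by move=> w _; rewrite -EFinM lee_fin; apply: mulr_ge0; rewrite ?sqr_ge0 ?mulr_ge0.
    - by apply: emeasurable_funM => //; exact/measurable_EFinP.
    - by move=> w _; rewrite -EFinM lee_fin; apply: mulr_ge0 => //; rewrite mulr_ge0 // sqr_ge0.
    - by apply: emeasurable_funM => //; exact/measurable_EFinP.
    apply: ge0_le_lower_integral => w _; rewrite -?EFinM -?EFinD lee_fin.
      by rewrite mulr_ge0 // sqr_ge0.
    move: (S k w) (J w) (X0 w) (XM w) => a b x0 xM.
    have h1 : b ^+ 2 <= 2 * (a - b) ^+ 2 + 2 * a ^+ 2 by have := sqr_ge0 (b - 2 * a); nra.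
    apply: (le_trans (ler_wpM2l x0 h1)); rewrite mulrDr [2 * (X w * _)]mulrCA lerD2r.
    by rewrite mulrA ler_wpM2r ?sqr_ge0 // mulrC ler_pM2l.
  have e2 := simple_integral_moment s0 tH (hs k) mX X0M.
  have e3 : (\int[P]_w (X w * Q w)%:E <=
      (2 * M)%:E * \int[P]_w V k w + 2%:E * \int[P]_w U w)%E.
    rewrite -!ge0_integralZl //; last by rewrite lee_fin mulr_ge0.
    rewrite -ge0_integralD //; last 4 first.
    - by move=> w _; apply: mule_ge0 => //; rewrite lee_fin mulr_ge0.
    - by apply: emeasurable_funM.
    - by move=> w _; apply: mule_ge0.
    - by apply: emeasurable_funM.
    apply: ge0_le_lower_integral => w _ //; rewrite lee_fin mulr_ge0 //.
    by rewrite -lee_fin -sQ integral_ge0 // => u _; rewrite lee_fin sqr_ge0.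
  apply: (le_trans e1); rewrite -addeA leeD2l //.
  apply: (le_trans (lee_wpmul2l _ (le_trans e2 (lee_wpmul2l _ e3)))); rewrite ?lee_fin //.
  rewrite ge0_muleDr ?mule_ge0 ?lee_fin ?mulr_ge0 // ge0_muleDr ?mule_ge0 ?lee_fin ?mulr_ge0 //.
  rewrite !muleA -!EFinM; apply: leeD.
    by rewrite (_ : 2 * kap * (2 * M) = kap * (4 * M)) //; ring.
  apply: (le_trans (lee_wpmul2l _ leU)); first by rewrite lee_fin !mulr_ge0.
  rewrite muleA -EFinM /ito_moment_const.
  by rewrite (_ : 2 * kap * 2 * (kap * (t - s) ^+ 2) = 4 * kap ^+ 2 * (t - s) ^+ 2) //; ring.
apply: (@cvge_to_ge _ \oo _ _ (fun k => ((2 * M)%:E * 'E_P[fun w => ((S k w - J w) ^+ 2)%R] +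
    (kap * (4 * M))%:E * \int[P]_w V k w) +
   (ito_moment_const * (t - s) ^+ 2)%:E * \int[P]_w (X w)%:E)%E); last exact: nearW.
have c1 : ((2 * M)%:E * 'E_P[fun w => ((S k w - J w) ^+ 2)%R])%E @[k --> \oo] --> (0 : \bar R)%E.
  by rewrite -[X in _ --> X](mule0 (2 * M)%:E); apply: cvgeZl => //; exact: cvgS.
have c2 : ((kap * (4 * M))%:E * \int[P]_w V k w)%E @[k --> \oo] --> (0 : \bar R)%E.
  by rewrite -[X in _ --> X](mule0 (kap * (4 * M))%:E); apply: cvgeZl => //; exact: cvgh.
rewrite -[X in _ --> X]add0e -[X in _ --> (X + _)%E](adde0 0%E).
apply: cvgeD; [by rewrite adde0 fin_num_adde_defr| |exact: cvg_cst].
exact: cvgeD.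
Qed.

(** The same bound for an arbitrary nonnegative weight, by monotone
    convergence. *)
Lemma ito_moment (A : R -> T -> R) (s t : R) (J X : T -> R) :
  scalar_brownian P H F A -> 0 <= s -> s < t -> t <= H ->
  is_ito_integral P F B s t (fun u w => A u w - A s w) J ->
  X \isF s -> (forall w, 0 <= X w) ->
  (\int[P]_w (X w * J w ^+ 2)%:E <=
   (ito_moment_const * (t - s) ^+ 2)%:E * \int[P]_w (X w)%:E)%E.
Proof.
move=> hA s0 st tH hJ mX X0; have [mJ _] := hJ.
have s_in : 0 <= s <= H by rewrite s0 (le_trans (ltW st)).
pose Y (n : nat) w := Num.min (X w) n%:R.
have Y0 n w : 0 <= Y n w by rewrite le_min X0 /=.
have YX n w : Y n w <= X w by rewrite ge_min lexx.
have mY n : Y n \isF s by apply: measurable_minr.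
have mYT n : measurable_fun setT (Y n) by exact: (measurable_filtration hF s_in (mY n)).
have ndY w : {homo (Y ^~ w) : n k / (n <= k)%N >-> n <= k}.
  by move=> n k nk; rewrite le_min ge_min lexx /= ge_min ler_nat nk orbT.
have cvgY w : Y n w @[n --> \oo] --> X w.
  apply: cvg_near_cst; exists (Num.truncn (X w)).+1 => // n /= Xn.
  apply: min_l; apply: ltW; apply: lt_le_trans (real_truncnS_gt _) _; first exact: num_real.
  by rewrite ler_nat.
have -> : (\int[P]_w (X w * J w ^+ 2)%:E =
    limn (fun n => \int[P]_w (Y n w * J w ^+ 2)%:E))%E.
  rewrite -monotone_convergence //.
  - apply: eq_integral => w _; apply/esym/cvg_lim => //.
    by apply: cvg_EFin; [exact: nearW|apply: cvgMr_tmp; exact: cvgY].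
  - by move=> n; apply/measurable_EFinP/measurable_funM => //; exact: measurable_funX.
  - by move=> n w _; rewrite lee_fin mulr_ge0 // sqr_ge0.
  - by move=> w _ n k nk; rewrite lee_fin ler_wpM2r ?sqr_ge0 //; exact: ndY.
apply: lime_le.
  apply: ereal_nondecreasing_is_cvgn => n k nk; apply: ge0_le_lower_integral => w _.
    by rewrite lee_fin mulr_ge0 // sqr_ge0.
  by rewrite lee_fin ler_wpM2r ?sqr_ge0 //; exact: ndY.
apply: nearW => n.
have Yn w : 0 <= Y n w <= n%:R by rewrite Y0 /= ge_min lexx orbT.
apply: (le_trans (ito_bounded_moment hA s0 st tH hJ (mY n) Yn)).
apply: lee_wpmul2l.
  by rewrite lee_fin mulr_ge0 ?sqr_ge0 // mulr_ge0 ?sqr_ge0.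
by apply: ge0_le_lower_integral => w _; rewrite lee_fin.
Qed.

End ito_moment.

(** * Measurability of random vectors and of sections *)

Section vector_measurability.
Context (R : realType) dd (T : measurableType dd) (d : nat).
Implicit Types (X Y : T -> 'rV[R]_d).

(** Measurability of a random vector, coordinate by coordinate. *)
Definition measurable_vec X := forall i, measurable_fun setT (fun w => X w ord0 i).

Lemma measurable_vecB X Y : measurable_vec X -> measurable_vec Y ->
  measurable_vec (fun w => X w - Y w).
Proof.
move=> mX mY i; under eq_fun do rewrite !mxE.
by apply: measurable_funB; [exact: mX|exact: mY].
Qed.

Lemma measurable_inner X Y : measurable_vec X -> measurable_vec Y ->
  measurable_fun setT (fun w => inner (X w) (Y w)).
Proof.
by move=> mX mY; apply: measurable_sum => i; apply: measurable_funM; [exact: mX|exact: mY].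
Qed.

Lemma measurable_fnorm X : measurable_vec X -> measurable_fun setT (fun w => fnorm (X w)).
Proof.
move=> mX.
have -> : (fun w => fnorm (X w)) = Num.sqrt \o (fun w => inner (X w) (X w)).
  by apply/funext => w /=; rewrite -sqr_fnorm sqrtr_sqr ger0_norm // fnorm_ge0.
apply: measurableT_comp; last exact: measurable_inner.
by apply: continuous_measurable_fun; exact: sqrt_continuous.
Qed.

Lemma measurable_vec_cst (x : 'rV[R]_d) : measurable_vec (fun=> x).
Proof. by move=> i; exact: measurable_cst. Qed.

Lemma rat_vec_dense (x : 'rV[R]_d) (e : R) : 0 < e ->
  exists q : 'rV[rat]_d, fnorm (x - map_mx ratr q) < e.
Proof.
move=> e0; have e1 : 0 < e / d.+1%:R by rewrite divr_gt0.
have h (i : 'I_d) : exists r : rat, `|x ord0 i - ratr r| < e / d.+1%:R.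
  have /rat_in_itvoo[r] : x ord0 i < x ord0 i + e / d.+1%:R by rewrite ltrDl.
  rewrite in_itv /= => /andP[h1 h2]; exists r; rewrite distrC ltr_distl.
  by rewrite h2 andbT (lt_trans _ h1) // gtrBl.
have [q hq] := fin_all_exists h.
exists (\row_i q i); set y := x - _.
apply: (@le_lt_trans _ _ (\sum_i `|y ord0 i|)).
  rewrite /fnorm big_ord1 -[leRHS]ger0_norm ?sumr_ge0 // -sqrtr_sqr ler_wsqrtr //.
  elim: (index_enum _) => [|i s IH]; first by rewrite !big_nil expr0n.
  rewrite !big_cons sqrrD real_normK ?num_real // -addrA lerD2l.
  by rewrite (le_trans IH) // lerDr mulrn_wge0 // mulr_ge0 // sumr_ge0.
apply: (@le_lt_trans _ _ (\sum_(i < d) e / d.+1%:R)).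
  by apply: ler_sum => i _; rewrite /y !mxE ltW.
rewrite sumr_const card_ord -[_ *+ d]mulr_natr mulrAC ltr_pdivrMr // ltr_pM2l //.
by rewrite ltr_nat.
Qed.

(** Composition of a Lipschitz function with a measurable vector: its strict
    sublevel sets are countable unions of preimages of balls with rational
    centers. *)
Lemma measurable_lipschitz_comp X (phi : 'rV[R]_d -> R) (K : R) : 0 <= K ->
  (forall x y, `|phi x - phi y| <= K * fnorm (x - y)) ->
  measurable_vec X -> measurable_fun setT (phi \o X).
Proof.
move=> K0 lip mX.
apply: (measurability _ (RGenInftyO.measurableE R)) => // _ [_ [c ->] <-].
pose E (q : 'rV[rat]_d) := [set w | phi (map_mx ratr q) + K * fnorm (X w - map_mx ratr q) < c].
have -> : setT `&` (phi \o X) @^-1` `]-oo, c[ = \bigcup_q E q.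
  rewrite setTI; apply/seteqP; split=> [w|w [q _]]; rewrite /= ?in_itv /=.
    move=> wc; have e0 : 0 < (c - phi (X w)) / (2 * K + 1).
      by rewrite divr_gt0 ?subr_gt0 // ltr_pwDr // mulr_ge0.
    have [q hq] := rat_vec_dense (X w) e0; exists q => //=.
    have K1 : 0 < 2 * K + 1 by rewrite ltr_pwDr // mulr_ge0.
    move: hq; rewrite ltr_pdivlMr // => hq.
    have := lip (X w) (map_mx ratr q); rewrite ler_norml => /andP[h1 _].
    rewrite /E /=; move: (fnorm_ge0 (X w - map_mx ratr q)) hq h1.
    move: (fnorm _) (phi (X w)) (phi _) => f a b; lra.
  rewrite /E /= => h; apply: le_lt_trans h.
  by have := lip (X w) (map_mx ratr q); rewrite ler_norml => /andP[_]; lra.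
apply: countable_bigcupT_measurable; first exact: countableP.
move=> q; rewrite /E.
have mf : measurable_fun setT (fun w => phi (map_mx ratr q) + K * fnorm (X w - map_mx ratr q)).
  apply: measurable_funD => //; apply: measurable_funM => //.
  by apply: measurable_fnorm; apply: measurable_vecB => //; exact: measurable_vec_cst.
have := mf measurableT _ (measurable_itv `]-oo, c[); rewrite setTI.
by congr (measurable _); apply/seteqP; split=> w; rewrite /= in_itv.
Qed.

End vector_measurability.

Section product_sigma_algebra.
Context (R : realType) d1 d2 (T1 : measurableType d1) (T2 : measurableType d2).
Context (F1 : set (set T1)) (F2 : set (set T2)).
Implicit Types (X : T1 * T2 -> R).

(** Sections of a variable that is measurable for a product sigma-algebra are
    measurable for the factor. *)
Lemma sub_measurable_section X y : sigma_algebra setT F1 ->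
  sub_measurable (sigma_prod F1 F2) X -> sub_measurable F1 (fun x => X (x, y)).
Proof.
move=> s1 hX _ [B mB <-]; rewrite setTI.
have : sigma_prod F1 F2 (X @^-1` B) by apply: hX; exists B => //; rewrite setTI.
have [F0 FC FU] := s1.
apply: (smallest_sub (X := [set C : set (T1 * T2) | F1 [set x | C (x, y)]])).
  split=> [|A FA|A FA]; first exact: F0.
    exact: (FC [set x | A (x, y)]).
  exact: (FU (fun i => [set x | A i (x, y)])).
move=> _ [A FA [C FC' <-]] /=.
have [Cy|nCy] := pselect (C y).
  by rewrite (_ : [set x | _] = A) //; apply/seteqP; split=> x /= => [[]|].
by rewrite (_ : [set x | _] = set0) //; apply/seteqP; split=> x /= => [[]|].
Qed.

Lemma sub_measurable_prod X : F1 `<=` measurable -> F2 `<=` measurable ->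
  sub_measurable (sigma_prod F1 F2) X -> measurable_fun setT X.
Proof.
move=> m1 m2 hX _ B mB; have : sigma_prod F1 F2 (setT `&` X @^-1` B) by apply: hX; exists B.
apply: smallest_sub; first exact: sigma_algebra_measurable.
by move=> _ [A FA [C FC <-]]; apply: measurableX; [exact: m1|exact: m2].
Qed.

End product_sigma_algebra.

(** * The estimates for a fixed randomization *)

Section one_step.
Context (R : realType) (H alpha kappa Kf Kg Mf Mg : R) (d m : nat).
Context (f : R -> 'rV[R]_d -> 'rV[R]_d) (g : 'I_m -> R -> 'rV[R]_d -> 'rV[R]_d).
Context (hKf : 0 < Kf) (hkappa : 0 <= kappa) (hKg : 0 < Kg).
Context (halpha : 0 < alpha < (2 * (kappa + 1))^-1).
Context (hf : drift_assumption H Kf kappa Mf f).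
Context (hg : diffusion_assumption H Kg Mg g).
Context (dd : measure_display) (Omega : measurableType dd) (P : probability Omega R).
Context (F : R -> set (set Omega)) (hF : filtration H F).
Context (W : 'I_m -> R -> Omega -> R) (hW : brownian_motion P H F W).
Context (I2 : 'I_m -> 'I_m -> R -> R -> Omega -> R).
Context (hI2 : iterated_integrals P H F W I2).
Context (s t e : R) (s0 : 0 <= s) (st : s < t) (tH : t <= H) (h1 : t - s <= 1).
Context (he : 0 < e <= t - s).

Notation h := (t - s).
Notation kap n := (normal_moment_const R n).
Local Notation "X \isF t" := (measurable_fun setT (X : g_sigma_algebraType (F t) -> R))
  (at level 70).

Let i r w := I1 W r s (s + e) w.
Let I r w := I1 W r s t w.
Let J r1 r2 w := I2 r1 r2 s t w.
Let nz w := noise h (i ^~ w) (I ^~ w) (fun r1 r2 => J r1 r2 w).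

Let h0 : 0 < h. Proof. by rewrite subr_gt0. Qed.
Let e0 : 0 < e. Proof. by case/andP: he. Qed.
Let eh : e <= h. Proof. by case/andP: he. Qed.
Let s_in : 0 <= s <= H. Proof. by rewrite s0 (le_trans (ltW st)). Qed.
Let se : s < s + e. Proof. by rewrite ltrDl. Qed.
Let seH : s + e <= H. Proof. by apply: le_trans tH; rewrite addrC -lerBrDr. Qed.
Let bm r : scalar_brownian P H F (W r) := brownian_coordinate r hW.

Let mi r : measurable_fun setT (i r).
Proof.
have hse : 0 <= s + e <= H by rewrite seH (le_trans s0) // ltW.
apply: (measurable_filtration hF hse).
exact: (measurable_increment hF (bm r) s0 (ltW se) seH).
Qed.

Let mI r : measurable_fun setT (I r).
Proof.
have ht : 0 <= t <= H by rewrite tH (le_trans s0) // ltW.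
apply: (measurable_filtration hF ht).
exact: (measurable_increment hF (bm r) s0 (ltW st) tH).
Qed.

Let mJ r1 r2 : measurable_fun setT (J r1 r2).
Proof. by have [] := hI2 r1 r2 s0 st tH. Qed.

Let kap_ge0 n : 0 <= kap n :> R. Proof. exact: normal_moment_const_ge0. Qed.

Lemma sum_le_scale (a : 'I_m -> \bar R) (c : R) (E : \bar R) : 0 <= c -> (0 <= E)%E ->
  (forall r, a r <= c%:E * E)%E -> (\sum_r a r <= (m%:R * c)%:E * E)%E.
Proof.
move=> c0 E0 hc; apply: (@le_trans _ _ (\sum_(r < m) c%:E * E)%E).
  by apply: lee_sum => r _; exact: hc.
rewrite -ge0_sume_distrl; last by move=> *; rewrite lee_fin.
by rewrite sumEFin sumr_const card_ord mulr_natl.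
Qed.

(** The factor of [h] in the conditional expectation of the noise: the terms come
    from [h] itself, from the two families of increments and from the iterated
    integrals. *)
Definition noise_const : R :=
  1 + m%:R * kap 1 + m%:R * kap 1 + m%:R * (m%:R * ito_moment_const R).

Lemma noise_const_ge0 : 0 <= noise_const.
Proof.
by rewrite !addr_ge0 ?mulr_ge0 ?(kap_ge0 1) // ito_moment_const_ge0.
Qed.

(** Given the past, the noise coefficient has expectation of order [h]. *)
Lemma noise_moment (X : Omega -> R) : X \isF s -> (forall w, 0 <= X w) ->
  measurable_fun setT nz /\
  (\int[P]_w (X w * nz w)%:E <= (noise_const * h)%:E * \int[P]_w (X w)%:E)%E.
Proof.
move=> mX X0; have mTX := measurable_filtration hF s_in mX.
have EX0 : (0 <= \int[P]_w (X w)%:E)%E by apply: integral_ge0 => w _; rewrite lee_fin.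
have mi2 r : measurable_fun setT (fun w => i r w ^+ 2) by apply: measurable_funX; exact: mi.
have mI2' r : measurable_fun setT (fun w => I r w ^+ 2) by apply: measurable_funX; exact: mI.
have mJ2 r1 r2 : measurable_fun setT (fun w => J r1 r2 w ^+ 2).
  by apply: measurable_funX; exact: mJ.
split.
  apply: measurable_funD; last first.
    apply: measurable_funM => //; apply: measurable_sum => r1.
    by apply: measurable_sum => r2; exact: mJ2.
  apply: measurable_funD; last by apply: measurable_sum => r; exact: mI2'.
  by apply: measurable_funD => //; apply: measurable_sum => r; exact: mi2.
have xE w : (X w * nz w)%:E = ((X w * h)%:E + \sum_r (X w * i r w ^+ 2)%:E +
    \sum_r (X w * I r w ^+ 2)%:E +
    \sum_r1 \sum_r2 (h^-1%:E * (X w * J r1 r2 w ^+ 2)%:E))%E.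
  have -> : (\sum_r1 \sum_r2 (h^-1%:E * (X w * J r1 r2 w ^+ 2)%:E) =
      (\sum_r1 \sum_r2 h^-1 * (X w * J r1 r2 w ^+ 2))%:E)%E.
    by rewrite -sumEFin; apply: eq_bigr => r1 _; rewrite -sumEFin.
  rewrite !sumEFin -!EFinD; congr EFin.
  rewrite /nz /noise !mulrDr !mulr_sumr; congr (_ + _).
  rewrite mulrA mulr_sumr mulr_suml; apply: eq_bigr => r1 _.
  by rewrite mulr_sumr mulr_suml; apply: eq_bigr => r2 _; rewrite mulrC.
under eq_integral do rewrite xE.
have nn c w : (0 <= (X w * c ^+ 2)%:E)%E by rewrite lee_fin mulr_ge0 // sqr_ge0.
have nnJ r1 r2 w : (0 <= h^-1%:E * (X w * J r1 r2 w ^+ 2)%:E)%E.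
  by rewrite mule_ge0 // lee_fin invr_ge0 ltW.
have mXi r : measurable_fun setT (fun w => (X w * i r w ^+ 2)%:E).
  by apply/measurable_EFinP; exact: measurable_funM.
have mXI r : measurable_fun setT (fun w => (X w * I r w ^+ 2)%:E).
  by apply/measurable_EFinP; exact: measurable_funM.
have mXJ r1 r2 : measurable_fun setT (fun w => (X w * J r1 r2 w ^+ 2)%:E).
  by apply/measurable_EFinP; exact: measurable_funM.
have mhXJ r1 r2 : measurable_fun setT (fun w => (h^-1%:E * (X w * J r1 r2 w ^+ 2)%:E)%E).
  exact: emeasurable_funM.
have mXh : measurable_fun setT (fun w => (X w * h)%:E).
  by apply/measurable_EFinP; exact: measurable_funM.
have Xh0 w : (0 <= (X w * h)%:E)%E by rewrite lee_fin mulr_ge0 // ltW.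
rewrite ge0_integralD //; last 4 first.
- by move=> w _; rewrite !adde_ge0 ?sume_ge0.
- apply: emeasurable_funD; last by apply: emeasurable_sum.
  by apply: emeasurable_funD => //; apply: emeasurable_sum.
- by move=> w _; apply: sume_ge0 => r1 _; exact: sume_ge0.
- by apply: emeasurable_sum => r1; exact: emeasurable_sum.
rewrite ge0_integralD //; last 4 first.
- by move=> w _; rewrite adde_ge0 ?sume_ge0.
- by apply: emeasurable_funD => //; apply: emeasurable_sum.
- by move=> w _; exact: sume_ge0.
- exact: emeasurable_sum.
rewrite ge0_integralD //; last 2 first.
- by move=> w _; exact: sume_ge0.
- exact: emeasurable_sum.
rewrite !ge0_integral_sum //; last 2 first.
- by move=> r1; exact: emeasurable_sum.
- by move=> r1 w _; exact: sume_ge0.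
have -> : ((noise_const * h)%:E * \int[P]_w (X w)%:E =
   h%:E * \int[P]_w (X w)%:E + (m%:R * (kap 1 * h))%:E * \int[P]_w (X w)%:E +
   (m%:R * (kap 1 * h))%:E * \int[P]_w (X w)%:E +
   (m%:R * (m%:R * (ito_moment_const R * h)))%:E * \int[P]_w (X w)%:E)%E.
  have k0 := kap_ge0 1; have i0 := ito_moment_const_ge0 R.
  have hh := ltW h0.
  have -> : noise_const * h = h + m%:R * (kap 1 * h) + m%:R * (kap 1 * h) +
      m%:R * (m%:R * (ito_moment_const R * h)) by rewrite /noise_const; ring.
  have k1 : 0 <= m%:R * (kap 1 * h) by apply: mulr_ge0 => //; exact: mulr_ge0.
  have k2 : 0 <= m%:R * (m%:R * (ito_moment_const R * h)).
    by apply: mulr_ge0 => //; apply: mulr_ge0 => //; exact: mulr_ge0.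
  have dist (a b c k : R) : 0 <= a -> 0 <= b -> 0 <= c -> 0 <= k ->
      ((a + b + c + k)%:E * \int[P]_w (X w)%:E = a%:E * \int[P]_w (X w)%:E +
       b%:E * \int[P]_w (X w)%:E + c%:E * \int[P]_w (X w)%:E +
       k%:E * \int[P]_w (X w)%:E)%E.
    by move=> *; rewrite !EFinD !ge0_muleDl ?adde_ge0 ?lee_fin.
  exact: dist.
apply: leeD; [apply: leeD; [apply: leeD|]|].
- under eq_integral do rewrite mulrC EFinM.
  rewrite ge0_integralZl //; [exact/measurable_EFinP| |].
    by move=> w _; rewrite lee_fin.
  by rewrite lee_fin ltW.
- apply: sum_le_scale => //; first by apply: mulr_ge0; [exact: kap_ge0|exact: ltW].
  move=> r; have := increment_moment hF (bm r) s0 se seH 1 mX X0.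
  rewrite expr1 muln1 => /le_trans; apply; apply: lee_wpmul2r => //.
  by rewrite lee_fin ler_wpM2l ?kap_ge0 // addrC addKr.
- apply: sum_le_scale => //; first by apply: mulr_ge0; [exact: kap_ge0|exact: ltW].
  by move=> r; have := increment_moment hF (bm r) s0 st tH 1 mX X0; rewrite expr1 muln1.
- apply: sum_le_scale => //.
    by apply: mulr_ge0 => //; apply: mulr_ge0; [exact: ito_moment_const_ge0|exact: ltW].
  move=> r1; rewrite ge0_integral_sum //.
  apply: sum_le_scale => //; first by apply: mulr_ge0; [exact: ito_moment_const_ge0|exact: ltW].
  move=> r2; rewrite ge0_integralZl //; last by rewrite lee_fin invr_ge0 ltW.
  have := ito_moment hF (bm r2) (bm r1) s0 st tH (hI2 r1 r2 s0 st tH) mX X0.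
  move=> le1; apply: le_trans (lee_wpmul2l _ le1) _; first by rewrite lee_fin invr_ge0 ltW.
  rewrite muleA -EFinM (_ : h^-1 * _ = ito_moment_const R * h) //.
  by field; rewrite gt_eqF.
Qed.

Let nz_ge0 w : 0 <= nz w.
Proof.
apply: addr_ge0; last first.
  rewrite divr_ge0 ?(ltW h0) //.
  by apply: sumr_ge0 => r1 _; apply: sumr_ge0 => r2 _; exact: sqr_ge0.
apply: addr_ge0; last by apply: sumr_ge0 => r _; exact: sqr_ge0.
by apply: addr_ge0; [exact: ltW|apply: sumr_ge0 => r _; exact: sqr_ge0].
Qed.

Lemma stab_const_ge0 : 0 <= stab_const Kf Kg m.
Proof.
apply: mulr_ge0; last exact: sqr_ge0.
by apply: mulr_ge0 => //; rewrite exprn_even_ge0.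
Qed.

Section two_variables.
Context (y z : Omega -> 'rV[R]_d).
Context (hy : sub_measurable_vec (F s) y) (hz : sub_measurable_vec (F s) z).

Let incr x w := increment alpha f g h s (s + e) e (i ^~ w) (I ^~ w)
  (fun r1 r2 => J r1 r2 w) x.
Let D2 w := fnorm (y w - z w) ^+ 2.

Let sF : sigma_algebra setT (F s). Proof. by case: hF => k _ _; exact: k. Qed.

Let my : @measurable_vec R _ (g_sigma_algebraType (F s)) d y.
Proof. by move=> k; apply/(sub_measurableP sF); exact: hy. Qed.
Let mz : @measurable_vec R _ (g_sigma_algebraType (F s)) d z.
Proof. by move=> k; apply/(sub_measurableP sF); exact: hz. Qed.

Let mD2 : D2 \isF s.
Proof.
by apply: measurable_funX; apply: measurable_fnorm; exact: measurable_vecB.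
Qed.

Let D2_ge0 w : 0 <= D2 w. Proof. exact: sqr_ge0. Qed.

Let mTD2 : measurable_fun setT D2.
Proof. exact: (measurable_filtration hF s_in mD2). Qed.

Let mnz : measurable_fun setT nz.
Proof. by have [] := noise_moment mD2 D2_ge0. Qed.

Let stab_noise_le : (\int[P]_w (stab_const Kf Kg m * (D2 w * nz w))%:E <=
  (stab_const Kf Kg m * noise_const * h)%:E * \int[P]_w (D2 w)%:E)%E.
Proof.
have [_ le1] := noise_moment mD2 D2_ge0.
under eq_integral do rewrite EFinM.
rewrite ge0_integralZl //.
- apply: (le_trans (lee_wpmul2l _ le1)); first by rewrite lee_fin stab_const_ge0.
  by rewrite muleA -EFinM mulrA.
- by apply/measurable_EFinP; exact: measurable_funM.
- by move=> w _; rewrite lee_fin mulr_ge0.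
- by rewrite lee_fin stab_const_ge0.
Qed.

Let hh : 0 < h <= 1. Proof. by rewrite h0 h1. Qed.
Let hse : 0 <= s + e <= H. Proof. by rewrite seH (le_trans s0) // ltW. Qed.
Let hee : 0 <= e <= h. Proof. by rewrite eh ltW. Qed.

(** The second estimate for a fixed randomization. *)
Lemma increment_diff_moment :
  (\int[P]_w (fnorm (incr (y w) w - incr (z w) w) ^+ 2)%:E <=
   (stab_const Kf Kg m * noise_const * h)%:E * \int[P]_w (fnorm (y w - z w) ^+ 2)%:E)%E.
Proof.
apply: le_trans stab_noise_le; apply: ge0_le_lower_integral => w _.
  by rewrite lee_fin sqr_ge0.
by rewrite lee_fin; exact: (increment_diff_le hKf hkappa hKg halpha hf hg hh s_in hse hee).
Qed.

(** The coefficient of the increment of [W r] in the term that is linear in the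
    noise; it is known at time [s]. *)
Let mart_coef r w := 2 * inner (y w - z w) (g r s (y w) - g r s (z w)).

Let m_mart_coef r : mart_coef r \isF s.
Proof.
have [_ [_ lip _ _ _]] := hg.
have mg x : @measurable_vec R _ (g_sigma_algebraType (F s)) d x ->
    @measurable_vec R _ (g_sigma_algebraType (F s)) d (fun w => g r s (x w)).
  move=> mx k.
  apply: (@measurable_lipschitz_comp R _ _ d x (fun v => g r s v ord0 k) Kg (ltW hKg)) => //.
  move=> u v; apply: le_trans (lip r s u v s_in).
  have -> : g r s u ord0 k - g r s v ord0 k = (g r s u - g r s v) ord0 k by rewrite !mxE.
  move: (g r s u - g r s v) => c; rewrite /fnorm big_ord1 -sqrtr_sqr ler_wsqrtr //.
  by rewrite (bigD1 k) //= lerDl sumr_ge0 // => j _; exact: sqr_ge0.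
apply: measurable_funM => //; apply: measurable_inner; apply: measurable_vecB => //; exact: mg.
Qed.

Let mart_coef_le r w : `|mart_coef r w| <= 2 * Kg * D2 w.
Proof.
have [_ [_ lip _ _ _]] := hg.
rewrite normrM ger0_norm // -mulrA ler_pM2l // (le_trans (ler_norm_inner _ _)) //.
rewrite mulrC /D2 expr2 mulrA ler_wpM2r ?fnorm_ge0 //; exact: lip.
Qed.

Let martingale_term : (\int[P]_w (D2 w)%:E < +oo)%E ->
  P.-integrable setT (fun w => (\sum_r mart_coef r w * I r w)%:E) /\
  (\int[P]_w (\sum_r mart_coef r w * I r w)%:E = 0)%E.
Proof.
move=> finD.
have iD : P.-integrable setT (EFin \o D2).
  apply/integrableP; split; first exact/measurable_EFinP.
  by under eq_integral do rewrite /= ger0_norm //.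
have finDI r : (\int[P]_w (D2 w * I r w ^+ 2)%:E < +oo)%E.
  have := increment_moment hF (bm r) s0 st tH 1 mD2 D2_ge0.
  rewrite muln1 => /le_lt_trans; apply; apply: lte_mul_pinfty => //.
  by rewrite lee_fin expr1; apply: mulr_ge0; [exact: kap_ge0|exact: ltW].
have mdn r : measurable_fun setT (mart_coef r).
  exact: (measurable_filtration hF s_in (m_mart_coef r)).
have iX r : P.-integrable setT (fun w => (mart_coef r w * I r w)%:E).
  have mDI : measurable_fun setT (fun w => D2 w * I r w ^+ 2).
    by apply: measurable_funM => //; exact: measurable_funX.
  have iDI : P.-integrable setT (EFin \o (fun w => D2 w * I r w ^+ 2)).
    apply/integrableP; split; first exact/measurable_EFinP.
    under eq_integral => w _ do
      rewrite /comp abse_EFin ger0_norm ?(mulr_ge0 (D2_ge0 w) (sqr_ge0 (I r w))) //.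
    exact: finDI.
  have := integrableD _ (integrableZl measurableT (2 * Kg) iD)
     (integrableZl measurableT (2 * Kg) iDI) => /(_ measurableT).
  apply: le_integrable => //; first by apply/measurable_EFinP; exact: measurable_funM.
  have k2 : 0 <= 2 * Kg by rewrite mulr_ge0 // ltW.
  move=> w _ /=; rewrite -?EFinM -?EFinD lee_fin.
  rewrite [leRHS]ger0_norm; last first.
    exact: addr_ge0 (mulr_ge0 k2 (D2_ge0 w))
      (mulr_ge0 k2 (mulr_ge0 (D2_ge0 w) (sqr_ge0 (I r w)))).
  rewrite normrM; apply: (@le_trans _ _ ((2 * Kg * D2 w) * `|I r w|)).
    by rewrite ler_wpM2r.
  rewrite -[leLHS]mulrA -mulrDr ler_wpM2l //.
  rewrite -[X in _ <= X + _]mulr1 -mulrDr ler_wpM2l //.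
  by rewrite -[I r w ^+ 2]real_normK ?num_real //; have := sqr_ge0 (1 - `|I r w|); nra.
split.
  by under eq_fun do rewrite -sumEFin; exact: integrable_sum.
under eq_integral do rewrite -sumEFin.
rewrite integral_sum // big1 // => r _.
exact: (increment_mean hF (bm r) s0 st tH (m_mart_coef r) (iX r)).
Qed.

Context (p : nat) (hp : 3 <= alpha * (2 * p)%:R).
Notation n := (p.+1).

(** The constant in front of h^3; the factor [1 + m%:R * kap n] bounds the moments
    of the increments. *)
Definition tail_const : R := 2 * resid_const Kf Kg Mf Mg m n * (1 + m%:R * kap n).

Let powi w := 1 + \sum_r i r w ^+ (2 * n).
Let even_ge0 (x : R) : 0 <= x ^+ (2 * n).
Proof. by rewrite exprM exprn_ge0 // sqr_ge0. Qed.

Let powi_ge0 w : 0 <= powi w.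
Proof. by rewrite addr_ge0 // sumr_ge0. Qed.

Let m_powi : measurable_fun setT powi.
Proof.
by apply: measurable_funD => //; apply: measurable_sum => r; exact: measurable_funX.
Qed.

Let powi_moment (X : Omega -> R) : X \isF s -> (forall w, 0 <= X w) ->
  (\int[P]_w (X w * powi w)%:E <= (1 + m%:R * kap n)%:E * \int[P]_w (X w)%:E)%E.
Proof.
move=> mX X0; have mTX := measurable_filtration hF s_in mX.
have EX0 : (0 <= \int[P]_w (X w)%:E)%E by apply: integral_ge0 => w _; rewrite lee_fin.
have xE w : (X w * powi w)%:E = ((X w)%:E + \sum_r (X w * i r w ^+ (2 * n))%:E)%E.
  by rewrite sumEFin -EFinD /powi mulrDr mulr1 mulr_sumr.
have mXi r : measurable_fun setT (fun w => (X w * i r w ^+ (2 * n))%:E).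
  by apply/measurable_EFinP/measurable_funM => //; exact: measurable_funX.
have nn r w : (0 <= (X w * i r w ^+ (2 * n))%:E)%E by rewrite lee_fin mulr_ge0.
under eq_integral do rewrite xE.
rewrite ge0_integralD //; last 4 first.
- by move=> w _; rewrite lee_fin.
- exact/measurable_EFinP.
- by move=> w _; exact: sume_ge0.
- exact: emeasurable_sum.
rewrite ge0_integral_sum // EFinD ge0_muleDl ?mul1e ?lee_fin ?mulr_ge0 ?kap_ge0 // leeD2l //.
apply: (sum_le_scale (kap_ge0 n)) => //.
move=> r; have := increment_moment hF (bm r) s0 se seH n mX X0.
move=> /le_trans; apply; apply: lee_wpmul2r => //.
rewrite lee_fin ler_piMr ?kap_ge0 // addrC addKr.
by rewrite exprn_ile1 ?(ltW e0) // (le_trans eh).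
Qed.

Let tail w := (1 + fnorm (y w) ^+ (2 * n)) + (1 + fnorm (z w) ^+ (2 * n)).

(** The first estimate for a fixed randomization. *)
Lemma increment_stability_moment :
  (\int[P]_w (fnorm (y w - z w + incr (y w) w - incr (z w) w) ^+ 2)%:E <=
   (1 + stab_const Kf Kg m * noise_const * h)%:E * \int[P]_w (fnorm (y w - z w) ^+ 2)%:E +
   (tail_const * h ^+ 3)%:E * \int[P]_w (tail w)%:E)%E.
Proof.
(* The integrand is bounded by the sum of the nonnegative measurable function [a]
   and of the term linear in the increments, which integrates to zero. If the
   right-hand side is infinite there is nothing to prove; otherwise the linear
   term is integrable. *)
pose c := 2 * resid_const Kf Kg Mf Mg m n * h ^+ 3.
have rc0 : 0 <= resid_const Kf Kg Mf Mg m n.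
  by rewrite /resid_const exprM exprn_ge0 // sqr_ge0.
have c0 : 0 <= c by rewrite mulr_ge0 ?exprn_ge0 ?(ltW h0) // mulr_ge0.
have mtail : tail \isF s.
  by apply: measurable_funD; apply: measurable_funD => //; apply: measurable_funX;
    apply: measurable_fnorm.
have tail0 w : 0 <= tail w by rewrite !addr_ge0.
have mTtail := measurable_filtration hF s_in mtail.
pose a w := D2 w + stab_const Kf Kg m * (D2 w * nz w) + c * (tail w * powi w).
have sc0 := stab_const_ge0.
have a1 w : 0 <= stab_const Kf Kg m * (D2 w * nz w).
  by apply: mulr_ge0 => //; exact: mulr_ge0.
have a2 w : 0 <= c * (tail w * powi w) by apply: mulr_ge0 => //; exact: mulr_ge0.
have a0 w : 0 <= a w by rewrite !addr_ge0.
have ma1 : measurable_fun setT (fun w => stab_const Kf Kg m * (D2 w * nz w)).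
  by do 2 apply: measurable_funM => //.
have ma2 : measurable_fun setT (fun w => c * (tail w * powi w)).
  by do 2 apply: measurable_funM => //.
have ma : measurable_fun setT a.
  by apply: measurable_funD => //; exact: measurable_funD.
set rhs := (X in (_ <= X)%E).
have le_a : (\int[P]_w (a w)%:E <= rhs)%E.
  under eq_integral do rewrite EFinD EFinD.
  rewrite ge0_integralD //; last 4 first.
  - by move=> w _; rewrite -EFinD lee_fin addr_ge0.
  - by apply: emeasurable_funD; apply/measurable_EFinP.
  - by move=> w _; rewrite lee_fin.
  - exact/measurable_EFinP.
  rewrite ge0_integralD //; last 4 first.
  - by move=> w _; rewrite lee_fin.
  - exact/measurable_EFinP.
  - by move=> w _; rewrite lee_fin.
  - exact/measurable_EFinP.
  rewrite /rhs; apply: leeD.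
    rewrite EFinD ge0_muleDl ?mul1e ?lee_fin //; last first.
      exact: mulr_ge0 (mulr_ge0 sc0 noise_const_ge0) (ltW h0).
    by rewrite leeD2l.
  under eq_integral do rewrite EFinM.
  rewrite ge0_integralZl //; last 2 first.
  - by apply/measurable_EFinP; exact: measurable_funM.
  - by move=> w _; rewrite lee_fin mulr_ge0.
  apply: (le_trans (lee_wpmul2l _ (powi_moment mtail tail0))); first by rewrite lee_fin.
  rewrite muleA -EFinM (_ : c * _ = tail_const * h ^+ 3) //.
  by rewrite /c /tail_const; ring.
have [->|rfin] := eqVneq rhs +oo%E; first by rewrite leey.
have lt_a : (\int[P]_w (a w)%:E < +oo)%E by apply: (le_lt_trans le_a); rewrite ltey.
have ia : P.-integrable setT (EFin \o a).
  apply/integrableP; split; first exact/measurable_EFinP.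
  by under eq_integral do rewrite /= ger0_norm //.
have lt_D : (\int[P]_w (D2 w)%:E < +oo)%E.
  apply: le_lt_trans lt_a; apply: ge0_le_lower_integral => w _; rewrite lee_fin //.
  by rewrite /a -addrA lerDl addr_ge0.
have [iL L0] := martingale_term lt_D.
apply: (le_trans _ le_a).
rewrite -[leRHS]adde0 -[X in (_ + X)%E]L0 -integralD //.
apply: ge0_le_lower_integral => w _; first by rewrite lee_fin sqr_ge0.
rewrite -EFinD lee_fin.
apply: (le_trans (increment_stability hKf hkappa hKg halpha hf hg hh s_in hse hee _ _ _ _ _)).
have ry := resid_stage_le hKf hkappa hKg halpha hf hg hh s_in hee (i ^~ w) (y w) hp.
have rz := resid_stage_le hKf hkappa hKg halpha hf hg hh s_in hee (i ^~ w) (z w) hp.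
rewrite /a /D2 /nz /mart_coef.
have -> : c * (tail w * powi w) =
   2 * (resid_const Kf Kg Mf Mg m n * h ^+ 3 * ((1 + fnorm (y w) ^+ (2 * n)) * powi w)) +
   2 * (resid_const Kf Kg Mf Mg m n * h ^+ 3 * ((1 + fnorm (z w) ^+ (2 * n)) * powi w)).
  by rewrite /c /tail; ring.
have gen (u v k x1 x2 x3 x4 : R) : x1 <= x3 -> x2 <= x4 ->
    u + v + k + (2 * x1 + 2 * x2) <= u + k + (2 * x3 + 2 * x4) + v by lra.
exact: gen ry rz.
Qed.

End two_variables.

End one_step.

(** * The stability estimate *)

Lemma grid_step_bounds (R : realType) (T : R) (N j : nat) (t : nat -> R) :
  grid T N t -> 0 < mesh N t <= 1 -> (1 <= j <= N)%N ->
  [/\ 0 <= t j.-1, t j.-1 < t j, t j <= T & step t j <= 1].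
Proof.
move=> [t0 tN tinc] /andP[_ mesh1] /andP[j1 jN].
have le_t := step_nodes_le tinc.
have jE : j = j.-1.+1 by rewrite prednK.
split.
- by rewrite -t0; apply: le_t => //; rewrite (leq_trans _ jN) // leq_pred.
- by rewrite [X in _ < t X]jE; apply: tinc; rewrite -jE.
- by rewrite -tN; exact: le_t.
- apply: le_trans mesh1; rewrite /mesh.
  by apply: (@le_bigmax_seq _ _ _ _ _ _ xpredT) => //; rewrite mem_index_iota j1.
Qed.

Lemma sigma_tau_measurable (R : realType) (dd : measure_display)
    (Omega : measurableType dd) (P : probability Omega R) (tau : nat -> Omega -> R) k :
  iid_uniform P tau -> sigma_tau tau k `<=` measurable.
Proof.
move=> [mtau _ _ _]; apply: smallest_sub; first exact: sigma_algebra_measurable.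
by move=> _ [l /andP[l0 _] [B mB <-]]; exact: mtau.
Qed.

(** Integration of an estimate that holds on every section; the function on the
    left need not be measurable. *)
Lemma integrate_sections (R : realType) d1 d2 (T1 : measurableType d1)
    (T2 : measurableType d2) (P1 : probability T1 R) (P2 : probability T2 R)
    (L D V : T1 * T2 -> R) (a b : R) :
  (forall z, 0 <= L z) -> (forall z, 0 <= D z) -> (forall z, 0 <= V z) ->
  0 <= a -> 0 <= b -> measurable_fun setT D -> measurable_fun setT V ->
  (forall y, \int[P1]_x (L (x, y))%:E <=
     a%:E * \int[P1]_x (D (x, y))%:E + b%:E * \int[P1]_x (V (x, y))%:E)%E ->
  (\int[P1 \x P2]_z (L z)%:E <=
     a%:E * \int[P1 \x P2]_z (D z)%:E + b%:E * \int[P1 \x P2]_z (V z)%:E)%E.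
Proof.
move=> L0 D0 V0 a0 b0 mD mV sec.
have mD' : measurable_fun setT (EFin \o D) by exact/measurable_EFinP.
have mV' : measurable_fun setT (EFin \o V) by exact/measurable_EFinP.
have D0' z : (0 <= (EFin \o D) z)%E by rewrite lee_fin.
have V0' z : (0 <= (EFin \o V) z)%E by rewrite lee_fin.
have mGD := measurable_fun_fubini_tonelli_G (m1 := P1) _ mD' D0'.
have mGV := measurable_fun_fubini_tonelli_G (m1 := P1) _ mV' V0'.
have GD0 y : (0 <= fubini_G P1 (EFin \o D) y)%E by exact: integral_ge0.
have GV0 y : (0 <= fubini_G P1 (EFin \o V) y)%E by exact: integral_ge0.
rewrite (fubini_tonelli2 (EFin \o D)) // (fubini_tonelli2 (EFin \o V)) //.
rewrite -!ge0_integralZl // -ge0_integralD //; last 4 first.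
- by move=> y _; rewrite mule_ge0.
- exact: emeasurable_funM.
- by move=> y _; rewrite mule_ge0.
- exact: emeasurable_funM.
apply: lower_integral_prod_le => //.
by apply: emeasurable_funD; exact: emeasurable_funM.
Qed.

(* [C] is chosen before the probability spaces, the coefficients, the grid,
   the index j and the random variables Y, Z: it depends only on T, d, m,
   alpha, the constants in the assumptions and the moment bounds Cq. *)
Theorem lemma4p1 (R : realType) (T : R) (d m : nat)
    (alpha kappa Kf Kg Mf Mg : R) (Cq : R -> R)
    (hT : 0 < T) (hKf : 0 < Kf) (hkappa : 0 <= kappa) (hKg : 0 < Kg)
    (halpha : 0 < alpha < (2 * (kappa + 1))^-1)
    (hCq : forall q, 1 <= q -> 0 < Cq q) :
  exists C : R, 0 < C /\
  forall (d1 d2 : measure_display)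
    (OW : measurableType d1) (Otau : measurableType d2)
    (PW : probability OW R) (Ptau : probability Otau R)
    (F : R -> set (set OW)) (W : 'I_m -> R -> OW -> R)
    (I2 : 'I_m -> 'I_m -> R -> R -> OW -> R)
    (tau : nat -> Otau -> R) (X0 : OW -> 'rV[R]_d)
    (f : R -> 'rV[R]_d -> 'rV[R]_d)
    (g : 'I_m -> R -> 'rV[R]_d -> 'rV[R]_d)
    (N : nat) (t : nat -> R) (j : nat)
    (Y Z : OW * Otau -> 'rV[R]_d),
  let P := (PW \x Ptau)%E in
  let Phij := Phi alpha f g W I2 tau t j in
  usual_conditions PW T F ->
  brownian_motion PW T F W ->
  iterated_integrals PW T F W I2 ->
  iid_uniform Ptau tau ->
  initial_value PW Ptau T F W tau X0 ->
  drift_assumption T Kf kappa Mf f ->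
  diffusion_assumption T Kg Mg g ->
  grid T N t -> 0 < mesh N t <= 1 ->
  (1 <= j <= N)%N ->
  sub_measurable_vec (sigma_prod (F (t j.-1)) (sigma_tau tau j.-1)) Y ->
  sub_measurable_vec (sigma_prod (F (t j.-1)) (sigma_tau tau j.-1)) Z ->
  (forall q, 1 <= q ->
    ('E_P[fun w => (fnorm (Y w) `^ q)%R] + 'E_P[fun w => (fnorm (Z w) `^ q)%R]
       <= (Cq q)%:E)%E) ->
  ('E_P[fun w => (fnorm (Y w - Z w + Phij (Y w) w - Phij (Z w) w) ^+ 2)%R]
     <= (1 + C * step t j)%:E * 'E_P[fun w => (fnorm (Y w - Z w) ^+ 2)%R]
        + (C * step t j ^+ 3)%:E)%E /\
  ('E_P[fun w => (fnorm (Phij (Y w) w - Phij (Z w) w) ^+ 2)%R]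
     <= (C * step t j)%:E * 'E_P[fun w => (fnorm (Y w - Z w) ^+ 2)%R])%E.
Proof.
have alpha0 : 0 < alpha by case/andP: halpha.
(* The order of the moments: 2 p alpha >= 3. *)
pose p := (Num.truncn (3 / (2 * alpha))).+1.
have hp : 3 <= alpha * (2 * p)%:R.
  have := @real_truncnS_gt R (3 / (2 * alpha)) (num_real _).
  rewrite -/p ltr_pdivrMr ?mulr_gt0 // => /ltW /le_trans; apply.
  by rewrite natrM mulrA mulrC [2 * alpha]mulrC.
pose q : R := (2 * p.+1)%:R.
have q1 : 1 <= q by rewrite /q ler1n muln_gt0.
pose K1 := stab_const Kf Kg m * noise_const R m.
pose K2 := tail_const Kf Kg Mf Mg m p.
have K1_ge0 : 0 <= K1 := mulr_ge0 (stab_const_ge0 Kf Kg m) (noise_const_ge0 R m).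
have K2_ge0 : 0 <= K2.
  apply: mulr_ge0; last by rewrite addr_ge0 // mulr_ge0 // normal_moment_const_ge0.
  by apply: mulr_ge0 => //; rewrite /resid_const exprM exprn_ge0 // sqr_ge0.
have Cq0 := ltW (hCq q q1).
pose C := K1 + K2 * (2 + Cq q) + 1.
have K3_ge0 : 0 <= K2 * (2 + Cq q) by rewrite mulr_ge0 // addr_ge0.
exists C; split; first by rewrite /C ltr_wpDl // addr_ge0.
move=> d1 d2 OW Otau PW Ptau F W I2 tau X0 f g N t j Y Z P Phij.
move=> [hF _ _] hW hI2 htau _ hf hg hgrid hmesh hj hY hZ hmom.
have [s0 st tT step1] := grid_step_bounds hgrid hmesh hj.
set h := step t j; have h0 : 0 < h by rewrite subr_gt0.
have s_in : 0 <= t j.-1 <= T by rewrite s0 (le_trans (ltW st)).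
have sF : sigma_algebra setT (F (t j.-1)) by case: hF => k _ _; exact: k.
have Fm : F (t j.-1) `<=` measurable by case: hF => _ k _; exact: k.
have taum := sigma_tau_measurable (k := j.-1) htau.
have mY : measurable_vec Y by move=> k; exact: (sub_measurable_prod Fm taum (hY k)).
have mZ : measurable_vec Z by move=> k; exact: (sub_measurable_prod Fm taum (hZ k)).
have sY w2 : sub_measurable_vec (F (t j.-1)) (fun w1 => Y (w1, w2)).
  by move=> k; exact: (sub_measurable_section sF (hY k)).
have sZ w2 : sub_measurable_vec (F (t j.-1)) (fun w1 => Z (w1, w2)).
  by move=> k; exact: (sub_measurable_section sF (hZ k)).
have he w2 : 0 < tau j w2 * h <= h.
  case: htau => _ tau01 _ _; case/andP: hj => j0 _.
  have /andP[a0 a1] := tau01 j w2 j0.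
  by rewrite mulr_gt0 //= ler_piMl // ltW.
pose D z := fnorm (Y z - Z z) ^+ 2.
pose V z := (1 + fnorm (Y z) ^+ (2 * p.+1)) + (1 + fnorm (Z z) ^+ (2 * p.+1)).
have D0 z : 0 <= D z by exact: sqr_ge0.
have V0 z : 0 <= V z by rewrite !addr_ge0 // exprn_ge0 // fnorm_ge0.
have mD : measurable_fun setT D.
  by apply: measurable_funX; apply: measurable_fnorm; exact: measurable_vecB.
have mYn : measurable_fun setT (fun z => fnorm (Y z) ^+ (2 * p.+1)).
  by apply: measurable_funX; exact: measurable_fnorm.
have mZn : measurable_fun setT (fun z => fnorm (Z z) ^+ (2 * p.+1)).
  by apply: measurable_funX; exact: measurable_fnorm.
have mV : measurable_fun setT V.
  by apply: measurable_funD; exact: measurable_funD.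
have ED0 : (0 <= \int[(PW \x Ptau)%E]_z (D z)%:E)%E.
  by apply: integral_ge0 => z _; rewrite lee_fin D0.
have leV : (\int[(PW \x Ptau)%E]_z (V z)%:E <= (2 + Cq q)%:E)%E.
  have := hmom q q1; rewrite unlock.
  under eq_integral do rewrite /q powR_mulrn ?fnorm_ge0 //.
  under [X in (_ + X)%E]eq_integral do rewrite /q powR_mulrn ?fnorm_ge0 //.
  move=> hm; rewrite EFinD; apply: le_trans (leeD2l _ hm).
  have nn (u : OW * Otau -> 'rV[R]_d) z : (0 <= (fnorm (u z) ^+ (2 * p.+1))%:E)%E.
    by rewrite lee_fin exprn_ge0 // fnorm_ge0.
  have mn (u : OW * Otau -> 'rV[R]_d) : measurable_fun setT (fun z => fnorm (u z) ^+ (2 * p.+1)) ->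
      (\int[(PW \x Ptau)%E]_z (1 + fnorm (u z) ^+ (2 * p.+1))%:E =
       1 + \int[(PW \x Ptau)%E]_z (fnorm (u z) ^+ (2 * p.+1))%:E)%E.
    move=> mu; under eq_integral do rewrite EFinD.
    rewrite ge0_integralD //; last exact/measurable_EFinP.
    rewrite integral_cst //; congr (_ + _)%E.
    have PT : (PW \x Ptau)%E setT = 1%E by exact: probability_setT.
    by rewrite -[RHS]mule1 -PT.
  have VE z : (V z)%:E = ((1 + fnorm (Y z) ^+ (2 * p.+1))%:E + (1 + fnorm (Z z) ^+ (2 * p.+1))%:E)%E.
    by rewrite -EFinD.
  under [leLHS]eq_integral do rewrite VE.
  rewrite ge0_integralD //; last 4 first.
  - by move=> z _; rewrite lee_fin addr_ge0 // exprn_ge0 // fnorm_ge0.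
  - by apply/measurable_EFinP; exact: measurable_funD.
  - by move=> z _; rewrite lee_fin addr_ge0 // exprn_ge0 // fnorm_ge0.
  - by apply/measurable_EFinP; exact: measurable_funD.
  by rewrite !mn // addeACA (_ : 2%:E = 1 + 1)%E // -EFinD.
have hstab w2 := increment_stability_moment hKf hkappa hKg halpha hf hg hF hW hI2
  s0 st tT step1 (he w2) (sY w2) (sZ w2) hp.
have hdiff w2 := increment_diff_moment hKf hkappa hKg halpha hf hg hF hW hI2
  s0 st tT step1 (he w2) (sY w2) (sZ w2).
rewrite unlock; split.
  have le1 : (\int[(PW \x Ptau)%E]_w
      (fnorm (Y w - Z w + Phij (Y w) w - Phij (Z w) w) ^+ 2)%:E <=
     (1 + K1 * h)%:E * \int[(PW \x Ptau)%E]_z (D z)%:E +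
     (K2 * h ^+ 3)%:E * \int[(PW \x Ptau)%E]_z (V z)%:E)%E.
    apply: integrate_sections => //.
    - by move=> z; exact: sqr_ge0.
    - by rewrite addr_ge0 // mulr_ge0 // ltW.
    - by rewrite mulr_ge0 // exprn_ge0 // ltW.
  apply: (le_trans le1); apply: leeD.
    apply: lee_wpmul2r => //; rewrite lee_fin lerD2l ler_wpM2r ?(ltW h0) //.
    by rewrite /C -addrA lerDl addr_ge0.
  apply: le_trans (lee_wpmul2l _ leV) _; first by rewrite lee_fin mulr_ge0 // exprn_ge0 // ltW.
  rewrite -EFinM lee_fin mulrAC; apply: ler_wpM2r; first by rewrite exprn_ge0 // ltW.
  by rewrite /C; lra.
have le2 : (\int[(PW \x Ptau)%E]_w (fnorm (Phij (Y w) w - Phij (Z w) w) ^+ 2)%:E <=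
     (K1 * h)%:E * \int[(PW \x Ptau)%E]_z (D z)%:E +
     0%:E * \int[(PW \x Ptau)%E]_z (V z)%:E)%E.
  apply: integrate_sections => //.
  - by move=> z; exact: sqr_ge0.
  - by rewrite mulr_ge0 // ltW.
  - by move=> w2; rewrite mul0e adde0; exact: hdiff.
apply: (le_trans le2); rewrite mul0e adde0; apply: lee_wpmul2r => //.
by rewrite lee_fin ler_wpM2r ?(ltW h0) // /C -addrA lerDl addr_ge0.
Qed.
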